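(* Let $\mathcal{T}$ be a Krull-Schmidt triangulated category, $\mathcal{S}$ a thick subcategory of $\mathcal{T}$ and $\mathcal{U}:=\mathcal{T}/\mathcal{S}$ the quotient triangulated category. Let $F:\mathcal{T}\to\mathcal{U}$ be the canonical functor. (a) If $\mathcal{S}$ is a contravariantly finite subcategory of $\mathcal{T}$, then for any $\mathcal{D}\in\mathrm{silt}\,\mathcal{S}$ we have an injective map $$\{\mathcal{M}\in\mathrm{silt}\,\mathcal{T}\mid\mathcal{D}\subset\mathcal{M}\}\to\mathrm{silt}\,\mathcal{U},\qquad \mathcal{M}\mapsto F\mathcal{M}.$$ (b) If $\mathcal{S}$ is a functorially finite subcategory of $\mathcal{T}$, then the map in (a) is bijective.
   Context: A ''subcategory'' always means a full subcategory closed under isomorphisms, finite coproducts and direct summands; $F\mathcal{M}$ is the subcategory of $\mathcal{U}$ given by the objects $F(M)$, $M\in\mathcal{M}$, understood in this sense. $\mathcal{T}$ is Krull-Schmidt if any object is a finite coproduct of objects with local endomorphism rings. For a triangulated category $\mathcal{V}$, a subcategory $\mathcal{M}$ of $\mathcal{V}$ is silting if $\mathrm{Hom}_{\mathcal{V}}(M,M'[i])=0$ for all $M,M'\in\mathcal{M}$, $i>0$, and the smallest thick subcategory of $\mathcal{V}$ containing $\mathcal{M}$ is $\mathcal{V}$. $\mathrm{silt}\,\mathcal{V}$ denotes the collection of silting subcategories of $\mathcal{V}$. A right $\mathcal{S}$-approximation of $Y$ is a morphism $f:S\to Y$ with $S\in\mathcal{S}$ such that $\mathrm{Hom}_{\mathcal{T}}(S',f)$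 is surjective for all $S'\in\mathcal{S}$; $\mathcal{S}$ is contravariantly finite in $\mathcal{T}$ if every object of $\mathcal{T}$ has a right $\mathcal{S}$-approximation. Left approximations and covariantly finite subcategories are defined dually; functorially finite means both contravariantly and covariantly finite. *)

(* Defs.v *)
From HB Require Import structures.
From mathcomp Require Import all_boot all_algebra.
From mathcomp Require Import boolp classical_sets functions.

Set Implicit Arguments.
Unset Strict Implicit.
Unset Printing Implicit Defensive.

Import GRing.Theory.
Local Open Scope classical_set_scope.
Local Open Scope ring_scope.

Reserved Notation "g \oc f" (at level 40, left associativity).

(** * Categories and functors *)

Record category := Category {
  obj :> Type;
  hom : obj -> obj -> Type;
  idc : forall X, hom X X;
  comp : forall X Y Z, hom Y Z -> hom X Y -> hom X Z;
  comp1c : forall X Y (f : hom X Y), comp (idc Y) f = f;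
  compc1 : forall X Y (f : hom X Y), comp f (idc X) = f;
  compcA : forall X Y Z W (h : hom Z W) (g : hom Y Z) (f : hom X Y),
    comp h (comp g f) = comp (comp h g) f
}.
Arguments idc {c} X.
Notation "g \oc f" := (comp g f).

Definition is_iso (C : category) (X Y : C) (f : hom X Y) : Prop :=
  exists g : hom Y X, g \oc f = idc X /\ f \oc g = idc Y.

Definition isomorphic (C : category) (X Y : C) : Prop :=
  exists f : hom X Y, is_iso f.

Definition is_coproduct (C : category) n (Y : 'I_n -> C) (X : C)
    (inj : forall k, hom (Y k) X) : Prop :=
  forall (Z : C) (g : forall k, hom (Y k) Z),
    exists! h : hom X Z, forall k, h \oc inj k = g k.

Record functor (C D : category) := Functor {
  fobj :> C -> D;
  fmap : forall X Y, hom X Y -> hom (fobj X) (fobj Y);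
  fmap_id : forall X, fmap (idc X) = idc (fobj X);
  fmap_comp : forall X Y Z (g : hom Y Z) (f : hom X Y),
    fmap (g \oc f) = fmap g \oc fmap f
}.
Arguments fmap {C D} f {X Y} _ : rename.

Definition functor_comp (C D E : category) (G : functor D E) (F : functor C D) :
  functor C E.
Proof.
refine (@Functor C E (fun X => G (F X)) (fun X Y f => fmap G (fmap F f)) _ _).
- by move=> X; rewrite !fmap_id.
- by move=> X Y Z g f; rewrite !fmap_comp.
Defined.

Definition natural (C D : category) (G H : functor C D)
    (a : forall X, hom (G X) (H X)) : Prop :=
  forall X Y (f : hom X Y), a Y \oc fmap G f = fmap H f \oc a X.

Definition autoequivalence (C : category) (F : functor C C) : Prop :=
  (forall X Y : C, bijective (@fmap C C F X Y)) /\
  (forall Y : C, exists X : C, isomorphic (F X) Y).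

(** [F : C -> D] exhibits [D] as the localization [C[W^-1]]; the universal
    property is the one of Kashiwara-Schapira, "Categories and Sheaves",
    Definition 7.1.1, which is invariant under equivalence of categories. *)
Definition localization (C D : category)
    (W : forall X Y : C, hom X Y -> Prop) (F : functor C D) : Prop :=
  [/\ forall (X Y : C) (f : hom X Y), W X Y f -> is_iso (fmap F f),
      forall (A : category) (G : functor C A),
        (forall (X Y : C) (f : hom X Y), W X Y f -> is_iso (fmap G f)) ->
        exists (H : functor D A) (a : forall X, hom (G X) (H (F X))),
          natural (H := functor_comp H F) a /\ forall X, is_iso (a X)
    & forall (A : category) (G H : functor D A)
        (a : forall X, hom (G (F X)) (H (F X))),
        natural (G := functor_comp G F) (H := functor_comp H F) a ->
        exists! b : forall Y, hom (G Y) (H Y),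
          natural b /\ forall X, b (F X) = a X].

(** * Additive categories *)

Record preadditive_category := PreadditiveCategory {
  pread_cat :> category;
  hom_zmod : forall X Y : pread_cat, GRing.Zmodule (hom X Y);
}.

Definition hom_zmodType (C : preadditive_category) (X Y : C) : zmodType :=
  GRing.Zmodule.Pack (hom_zmod X Y).

HB.instance Definition _ (C : preadditive_category) (X Y : C) :=
  GRing.Zmodule.copy (hom X Y) (hom_zmodType X Y).

Record additive_category := AdditiveCategory {
  add_cat :> preadditive_category;
  compDl : forall (X Y Z : add_cat) (g g' : hom Y Z) (f : hom X Y),
    (g + g') \oc f = g \oc f + g' \oc f;
  compDr : forall (X Y Z : add_cat) (g : hom Y Z) (f f' : hom X Y),
    g \oc (f + f') = g \oc f + g \oc f';
  has_coproducts : forall n (Y : 'I_n -> add_cat),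
    exists (X : add_cat) (inj : forall k, hom (Y k) X), is_coproduct inj
}.

Definition zero_object (C : additive_category) (Z : C) : Prop :=
  (forall (X : C) (f : hom X Z), f = 0) /\ (forall (X : C) (f : hom Z X), f = 0).

Definition additive_functor (C D : additive_category) (F : functor C D) : Prop :=
  forall (X Y : C) (f g : hom X Y), fmap F (f + g) = fmap F f + fmap F g.

Definition local_endomorphism_ring (C : additive_category) (X : C) : Prop :=
  idc X <> 0 /\
  forall f g : hom X X, ~ is_iso f -> ~ is_iso g -> ~ is_iso (f + g).

Definition krull_schmidt (C : additive_category) : Prop :=
  forall X : C, exists n (Y : 'I_n -> C) (inj : forall k, hom (Y k) X),
    is_coproduct inj /\ forall k, local_endomorphism_ring (Y k).

(** * Triangulated categories *)

(** The shift is only required to be an autoequivalence, not an automorphism. *)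
Record triangulated_category := TriangulatedCategory {
  tri_cat :> additive_category;
  shift : functor tri_cat tri_cat;
  shift_additive : additive_functor shift;
  shift_autoequivalence : autoequivalence shift;
  dist : forall X Y Z : tri_cat, hom X Y -> hom Y Z -> hom Z (shift X) -> Prop;
  (* TR1 *)
  dist_iso : forall (X Y Z X' Y' Z' : tri_cat)
      (f : hom X Y) (g : hom Y Z) (h : hom Z (shift X))
      (f' : hom X' Y') (g' : hom Y' Z') (h' : hom Z' (shift X'))
      (u : hom X X') (v : hom Y Y') (w : hom Z Z'),
    is_iso u -> is_iso v -> is_iso w ->
    v \oc f = f' \oc u -> w \oc g = g' \oc v -> fmap shift u \oc h = h' \oc w ->
    dist f g h -> dist f' g' h';
  dist_id : forall X Z : tri_cat, zero_object Z ->
    dist (idc X) (0 : hom X Z) (0 : hom Z (shift X));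
  dist_complete : forall (X Y : tri_cat) (f : hom X Y),
    exists (Z : tri_cat) (g : hom Y Z) (h : hom Z (shift X)), dist f g h;
  (* TR2 *)
  dist_rotate : forall (X Y Z : tri_cat)
      (f : hom X Y) (g : hom Y Z) (h : hom Z (shift X)),
    dist f g h <-> dist g h (- fmap shift f);
  (* TR3 *)
  dist_morphism : forall (X Y Z X' Y' Z' : tri_cat)
      (f : hom X Y) (g : hom Y Z) (h : hom Z (shift X))
      (f' : hom X' Y') (g' : hom Y' Z') (h' : hom Z' (shift X'))
      (u : hom X X') (v : hom Y Y'),
    dist f g h -> dist f' g' h' -> v \oc f = f' \oc u ->
    exists w : hom Z Z', w \oc g = g' \oc v /\ fmap shift u \oc h = h' \oc w;
  (* TR4 *)
  dist_octahedron : forall (X Y Z A B C : tri_cat)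
      (f : hom X Y) (f1 : hom Y A) (f2 : hom A (shift X))
      (g : hom Y Z) (g1 : hom Z B) (g2 : hom B (shift Y))
      (h1 : hom Z C) (h2 : hom C (shift X)),
    dist f f1 f2 -> dist g g1 g2 -> dist (g \oc f) h1 h2 ->
    exists (u : hom A C) (v : hom C B),
      [/\ dist u v (fmap shift f1 \oc g2),
          u \oc f1 = h1 \oc g, h2 \oc u = f2,
          v \oc h1 = g1 & g2 \oc v = fmap shift f \oc h2]
}.

Record triangle_functor (T U : triangulated_category) := TriangleFunctor {
  tf_functor :> functor T U;
  tf_additive : additive_functor tf_functor;
  tf_shift : forall X : T, hom (tf_functor (shift T X)) (shift U (tf_functor X));
  tf_shift_iso : forall X, is_iso (tf_shift X);
  tf_shift_natural :
    natural (G := functor_comp tf_functor (shift T))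
            (H := functor_comp (shift U) tf_functor) tf_shift;
  tf_dist : forall (X Y Z : T)
      (f : hom X Y) (g : hom Y Z) (h : hom Z (shift T X)),
    dist f g h ->
    dist (fmap tf_functor f) (fmap tf_functor g)
         (tf_shift X \oc fmap tf_functor h)
}.

(** * Subcategories, given by their sets of objects *)

(** The last clause is closure under finite coproducts (right to left) and
    direct summands (left to right). *)
Definition subcategory (C : additive_category) (N : set C) : Prop :=
  (forall X Y : C, isomorphic X Y -> N X -> N Y) /\
  (forall n (Y : 'I_n -> C) (X : C) (inj : forall k, hom (Y k) X),
    is_coproduct inj -> (N X <-> forall k, N (Y k))).

Definition thick (T : triangulated_category) (N : set T) : Prop :=
  [/\ subcategory N,
      forall X : T, N X <-> N (shift T X)
    & forall (X Y Z : T) (f : hom X Y) (g : hom Y Z) (h : hom Z (shift T X)),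
        dist f g h -> N X -> N Y -> N Z].

(** [silt V] is the set of silting subcategories of a thick subcategory [V] of
    [T], regarded as a triangulated category; [silt [set: T]] is the case of [T]
    itself.  Thick subcategories of [V] are those of [T] contained in [V]. *)
Definition silt (T : triangulated_category) (V : set T) : set (set T) :=
  [set M | [/\ subcategory M, M `<=` V,
      forall X Y : T, M X -> M Y -> forall i, (0 < i)%N ->
        forall f : hom X (iter i (shift T) Y), f = 0
    & smallest [set N | thick N /\ N `<=` V] M = V]].

Definition right_approximation (C : category) (S : set C) (X Y : C)
    (f : hom X Y) : Prop :=
  S X /\ forall X' : C, S X' ->
    forall g : hom X' Y, exists h : hom X' X, f \oc h = g.

Definition left_approximation (C : category) (S : set C) (Y X : C)
    (f : hom Y X) : Prop :=
  S X /\ forall X' : C, S X' ->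
    forall g : hom Y X', exists h : hom X X', h \oc f = g.

Definition contravariantly_finite (C : category) (S : set C) : Prop :=
  forall Y : C, exists (X : C) (f : hom X Y), right_approximation S f.

Definition covariantly_finite (C : category) (S : set C) : Prop :=
  forall Y : C, exists (X : C) (f : hom Y X), left_approximation S f.

Definition functorially_finite (C : category) (S : set C) : Prop :=
  contravariantly_finite S /\ covariantly_finite S.

(** [F M]: the image on objects need not be closed under isomorphisms or direct
    summands. *)
Definition image_subcategory (C D : additive_category) (F : functor C D)
    (M : set C) : set D :=
  smallest (@subcategory D) (F @` M).

(** [U] is the quotient [T/S] with canonical functor [F]: the localization of
    [T] at the morphisms whose cone lies in [S], with the triangulated structure
    for which [F] is a triangle functor. *)
Definition verdier_quotient (T U : triangulated_category) (S : set T)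
    (F : triangle_functor T U) : Prop :=
  localization (C := T) (D := U)
    (fun X Y f => exists (Z : T) (g : hom Y Z) (h : hom Z (shift T X)),
       dist f g h /\ S Z)
    F.

(* Main.v *)
(* Write [X[i]] for the shifts of [X], and call [X] left (right) orthogonal to [D]
   when Hom(X, D[i]) = 0 (Hom(D, X[i]) = 0) for all i > 0.  Every object of [S] is a
   retract of an object [C] with a decomposition in N * D * P, where N is the part of
   [S] sent to zero by Hom(-, Y[i]), i >= 0, for all right orthogonal [Y], and P is
   defined dually.  Hence, for [X] left orthogonal and [Y] right orthogonal, a
   morphism from [X] to [S] factors through an object of N * D, which has no morphism
   to Y[i] for i > 0.  By calculus of fractions Hom(X, Y[i]) -> Hom(FX, FY[i]) is then
   surjective for i >= 0 and injective for i > 0, and for i = 0 its kernel consists of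
   the morphisms factoring through [D].  Objects of a silting [M] containing [D] are
   orthogonal on both sides, so [F M] is silting, and an object X of [M] with FX a
   retract of FY, Y in [M'], is a retract of some Y + A with A in [D].
   For surjectivity, a silting [L] comes from the objects of F^-1(L) orthogonal on both
   sides: an arbitrary object is made right (left) orthogonal, without changing its
   image, by killing its morphisms from (to) the shifts of [D] one shift at a time,
   with [S]-approximations. *)

From mathcomp Require Import all_boot all_algebra.
From mathcomp Require Import boolp classical_sets functions.
Require Import Defs.

Set Implicit Arguments.
Unset Strict Implicit.
Unset Printing Implicit Defensive.

Import GRing.Theory.
Local Open Scope classical_set_scope.
Local Open Scope ring_scope.

(** * Isomorphisms, retracts and biproducts *)

Definition retract (C : category) (X Y : C) : Prop :=
  exists (i : hom X Y) (r : hom Y X), r \oc i = idc X.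

Definition homzero (C : additive_category) (X Y : C) : Prop :=
  forall f : hom X Y, f = 0.

Section Category.
Context (C : category).

Lemma is_iso_id (X : C) : is_iso (idc X).
Proof. by exists (idc X); rewrite compc1. Qed.

Lemma is_iso_comp (X Y Z : C) (g : hom Y Z) (f : hom X Y) :
  is_iso g -> is_iso f -> is_iso (g \oc f).
Proof.
move=> [g' [gK Kg]] [f' [fK Kf]]; exists (f' \oc g'); split.
- by rewrite -compcA (compcA g') gK comp1c.
- by rewrite -compcA (compcA f) Kf comp1c.
Qed.

(** The hypotheses give [f] a left inverse [a \oc g] and a right inverse [g' \oc b], and these must
    coincide. *)
Lemma is_iso_split (X Y : C) (f : hom X Y) (g g' : hom Y X) :
  is_iso (g \oc f) -> is_iso (f \oc g') -> is_iso f.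
Proof.
move=> [a [ga ag]] [b [fb bf]].
have E : a \oc g = g' \oc b.
  rewrite -[a \oc g]compc1 -bf (compcA _ _ b) -(compcA a) (compcA g).
  by rewrite compcA ga comp1c.
by exists (a \oc g); split; [rewrite -compcA | rewrite E compcA].
Qed.

Lemma isomorphic_refl (X : C) : isomorphic X X.
Proof. by exists (idc X); apply: is_iso_id. Qed.

Lemma isomorphic_sym (X Y : C) : isomorphic X Y -> isomorphic Y X.
Proof. by move=> [f [g [fK Kf]]]; exists g, f. Qed.

Lemma isomorphic_trans (Y X Z : C) :
  isomorphic X Y -> isomorphic Y Z -> isomorphic X Z.
Proof.
by move=> [f fi] [g gi]; exists (g \oc f); apply: is_iso_comp.
Qed.

Lemma retract_refl (X : C) : retract X X.
Proof. by exists (idc X), (idc X); rewrite compc1. Qed.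

Lemma isomorphic_retract (X Y : C) : isomorphic X Y -> retract X Y.
Proof. by move=> [f [g [fK Kf]]]; exists f, g. Qed.

Lemma retract_trans (Y X Z : C) : retract X Y -> retract Y Z -> retract X Z.
Proof.
move=> [i [r ri]] [j [s sj]]; exists (j \oc i), (r \oc s).
by rewrite -compcA (compcA s) sj comp1c.
Qed.

End Category.

Lemma fmap_iso (C D : category) (F : functor C D) (X Y : C) (f : hom X Y) :
  is_iso f -> is_iso (fmap F f).
Proof.
by move=> [g [fK Kf]]; exists (fmap F g); rewrite -!fmap_comp fK Kf !fmap_id.
Qed.

Lemma fmap_isomorphic (C D : category) (F : functor C D) (X Y : C) :
  isomorphic X Y -> isomorphic (F X) (F Y).
Proof. by move=> [f fi]; exists (fmap F f); apply: fmap_iso. Qed.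

Lemma fmap_retract (C D : category) (F : functor C D) (X Y : C) :
  retract X Y -> retract (F X) (F Y).
Proof.
move=> [i [r ri]]; exists (fmap F i), (fmap F r).
by rewrite -fmap_comp ri fmap_id.
Qed.

(** * Additive categories and biproducts *)

Section Additive.
Context (C : additive_category).
Implicit Types X Y Z W : C.

Lemma comp0r X Y Z (f : hom X Y) : (0 : hom Y Z) \oc f = 0.
Proof. by apply: (addrI (0 \oc f)); rewrite -compDl !addr0. Qed.

Lemma compr0 X Y Z (g : hom Y Z) : g \oc (0 : hom X Y) = 0.
Proof. by apply: (addrI (g \oc 0)); rewrite -compDr !addr0. Qed.

Lemma compNl X Y Z (g : hom Y Z) (f : hom X Y) : (- g) \oc f = - (g \oc f).
Proof. by apply: (addrI (g \oc f)); rewrite -compDl !subrr comp0r. Qed.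

Lemma compNr X Y Z (g : hom Y Z) (f : hom X Y) : g \oc (- f) = - (g \oc f).
Proof. by apply: (addrI (g \oc f)); rewrite -compDr !subrr compr0. Qed.

Lemma compBl X Y Z (g g' : hom Y Z) (f : hom X Y) :
  (g - g') \oc f = g \oc f - g' \oc f.
Proof. by rewrite compDl compNl. Qed.

Lemma compBr X Y Z (g : hom Y Z) (f f' : hom X Y) :
  g \oc (f - f') = g \oc f - g \oc f'.
Proof. by rewrite compDr compNr. Qed.

Lemma comp_suml X Y Z n (g : 'I_n -> hom Y Z) (f : hom X Y) :
  (\sum_i g i) \oc f = \sum_i g i \oc f.
Proof.
apply: (big_morph (fun x => x \oc f) _ (comp0r Z f)) => x y; exact: compDl.
Qed.

Lemma zero_objectP Z : zero_object Z <-> idc Z = 0.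
Proof.
split=> [[+ _]|E]; first exact.
split=> X f; first by rewrite -[f]comp1c E comp0r.
by rewrite -[f]compc1 E compr0.
Qed.

Lemma zero_object_exists : exists Z : C, zero_object Z.
Proof.
have Y (k : 'I_0) : C by case: k.
have [Z [inj ZP]] := has_coproducts Y.
exists Z; apply/zero_objectP.
have [h [_ hu]] := ZP Z (fun k => 0).
by transitivity h; [symmetry|]; apply: hu => -[].
Qed.

Lemma zero_object_retract Z X : zero_object Z -> retract Z X.
Proof. by move=> zZ; exists 0, 0; rewrite (proj1 (zero_objectP Z) zZ) comp0r. Qed.

Lemma homzero_retract X X' Y Y' :
  retract X X' -> retract Y Y' -> homzero X' Y' -> homzero X Y.
Proof.
move=> [i [r ri]] [j [s sj]] z f.
have := z (j \oc f \oc r) => /(congr1 (fun g => s \oc g \oc i)).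
by rewrite compr0 comp0r -!compcA ri compc1 compcA sj comp1c.
Qed.

Lemma homzero_iso X X' Y Y' :
  isomorphic X X' -> isomorphic Y Y' -> homzero X' Y' -> homzero X Y.
Proof. by move=> /isomorphic_retract ? /isomorphic_retract; apply: homzero_retract. Qed.

Definition biproduct X Y Z (i : hom X Y) (p : hom Y X) (j : hom Z Y) (q : hom Y Z)
    : Prop :=
  [/\ p \oc i = idc X, q \oc j = idc Z, q \oc i = 0, p \oc j = 0
    & i \oc p + j \oc q = idc Y].

(** The projections come from the universal property applied to Kronecker-delta families; the sum
    formula holds because both sides agree on every [inj k]. *)
Lemma coproduct_projections n (Y : 'I_n -> C) X (inj : forall k, hom (Y k) X) :
  is_coproduct inj ->
  exists p : forall k, hom X (Y k),
    [/\ forall k, p k \oc inj k = idc (Y k),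
        forall k l, k != l -> p k \oc inj l = 0
      & \sum_k inj k \oc p k = idc X].
Proof.
move=> coP.
have pex k : exists p : hom X (Y k),
    p \oc inj k = idc (Y k) /\ forall l, k != l -> p \oc inj l = 0.
  (* The match transports the identity of [Y l] along [l = k]; off the diagonal the value is
     zero. *)
  pose g l : hom (Y l) (Y k) :=
    match eqVneq l k with
    | EqNotNeq e => match e in _ = k' return hom (Y l) (Y k') with erefl => idc (Y l) end
    | NeqNotEq _ => 0 end.
  have [h [hP _]] := coP _ g; exists h; split=> [|l nkl]; rewrite hP /g.
  - by case: eqVneq => [e|/eqP//]; rewrite (eq_irrelevance e erefl).
  - by case: eqVneq nkl => // ->; rewrite eqxx.
pose p k := sval (cid (pex k)).
have pK k : p k \oc inj k = idc (Y k) by have [] := svalP (cid (pex k)).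
have p0 k l : k != l -> p k \oc inj l = 0 by have [_] := svalP (cid (pex k)); apply.
exists p; split=> //.
have [h [_ hu]] := coP _ inj.
transitivity h; [symmetry|]; apply: hu => k; last by rewrite comp1c.
rewrite comp_suml (bigD1 k) //= -compcA pK compc1 big1 ?addr0 // => l nlk.
by rewrite -compcA p0 // compr0.
Qed.

(** Matching on [val k] lets both components reduce at [ord0] and [ord_max], so [biproduct_exists]
    needs no casts. *)
Definition pair_obj X Z (k : 'I_2) : C := match val k with 0%N => X | _ => Z end.

Definition pair_mor X Y Z (i : hom X Y) (j : hom Z Y) (k : 'I_2) :
    hom (pair_obj X Z k) Y :=
  match val k as m return hom (match m with 0%N => X | _ => Z end) Y with
  | 0%N => i | _ => j end.

Lemma biproduct_is_coproduct X Y Z (i : hom X Y) p (j : hom Z Y) q :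
  biproduct i p j q -> is_coproduct (pair_mor i j).
Proof.
move=> [pi qj qi pj E] W g.
exists (g ord0 \oc p + g ord_max \oc q); split=> [[[|[|//]] k2]|h hP].
- rewrite /pair_mor /= compDl -!compcA pi qi compc1 compr0 addr0.
  by rewrite (bool_irrelevance k2 (ltn0Sn 1)).
- rewrite /pair_mor /= compDl -!compcA pj qj compc1 compr0 add0r.
  by rewrite (bool_irrelevance k2 (ltnSn 1)).
- by rewrite -[h]compc1 -E compDr !compcA -!hP.
Qed.

Lemma biproduct_exists X Z :
  exists Y (i : hom X Y) p (j : hom Z Y) q, biproduct i p j q.
Proof.
have [Y [inj /coproduct_projections[p [pi pj E]]]] := has_coproducts (pair_obj X Z).
exists Y, (inj ord0), (p ord0), (inj ord_max), (p ord_max); split.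
- exact: (pi ord0).
- exact: (pi ord_max).
- exact: (pj ord_max ord0).
- exact: (pj ord0 ord_max).
- by move: E; rewrite big_ord_recl big_ord1 (_ : lift _ _ = ord_max) //; apply/val_inj.
Qed.

Lemma biproduct_isomorphic X Y Z (i : hom X Y) p (j : hom Z Y) q
    X' Y' Z' (i' : hom X' Y') p' (j' : hom Z' Y') q' :
  biproduct i p j q -> biproduct i' p' j' q' ->
  isomorphic X X' -> isomorphic Z Z' -> isomorphic Y Y'.
Proof.
have K X1 Y1 Z1 (i1 : hom X1 Y1) p1 (j1 : hom Z1 Y1) q1
    X2 Y2 Z2 (i2 : hom X2 Y2) p2 (j2 : hom Z2 Y2) q2 u v w t :
    biproduct i1 p1 j1 q1 -> biproduct i2 p2 j2 q2 ->
    v \oc u = idc X1 -> t \oc w = idc Z1 ->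
    (i1 \oc v \oc p2 + j1 \oc t \oc q2) \oc (i2 \oc u \oc p1 + j2 \oc w \oc q1) = idc Y1.
  move=> [_ _ _ _ E1] [pi qj qi pj _] vu tw.
  rewrite compDl !compDr -!compcA (compcA p2) pi (compcA p2) pj.
  rewrite (compcA q2) qi (compcA q2) qj !comp0r !comp1c !compr0 addr0 add0r.
  by rewrite (compcA v) vu (compcA t) tw !comp1c.
move=> b b' [u [v [vu uv]]] [w [t [tw wt]]].
exists (i' \oc u \oc p + j' \oc w \oc q), (i \oc v \oc p' + j \oc t \oc q').
by split; apply: K.
Qed.

(** Reduces [n]-ary coproducts to binary ones. Thanks to closure under retracts, a coproduct only
    has to be exhibited as a retract of some object of [N]. *)
Lemma subcategory_intro (N : set C) :
  (forall Z, zero_object Z -> N Z) ->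
  (forall X Y, retract X Y -> N Y -> N X) ->
  (forall X Z, N X -> N Z ->
     exists Y (i : hom X Y) p (j : hom Z Y) q, biproduct i p j q /\ N Y) ->
  subcategory N.
Proof.
move=> N0 Nr Nb; split.
  by move=> X Y /isomorphic_sym/isomorphic_retract; apply: Nr.
move=> n Y X inj /coproduct_projections[p [pi pj E]]; split=> [NX k|NY].
  by apply: (Nr _ X) => //; exists (inj k), (p k).
(* By induction on [m], the partial sum of the idempotents [inj k \oc p k] factors through an object
   of [N]; at [m = n] this sum is the identity. *)
have partial m : (m <= n)%N -> exists Z (i : hom X Z) (r : hom Z X),
    N Z /\ r \oc i = \sum_(k < n | (k < m)%N) inj k \oc p k.
  elim: m => [_|m IH mn].
    have [Z zZ] := zero_object_exists.
    by exists Z, 0, 0; rewrite comp0r big_pred0 //; split=> //; apply: N0.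
  have [Z [i [r [NZ ri]]]] := IH (ltnW mn).
  pose k := Ordinal mn.
  have [W [a [b [c [d [[ba dc da bc _] NW]]]]]] := Nb _ _ NZ (NY k).
  exists W, (a \oc i + c \oc p k), (r \oc b + inj k \oc d); split=> //.
  rewrite (bigD1 k) //= compDl !compDr -!compcA.
  rewrite (compcA b a) ba (compcA b c) bc (compcA d a) da (compcA d c) dc.
  rewrite !comp0r !comp1c !compr0 addr0 add0r ri addrC; congr (_ + _).
  apply: eq_bigl => l; rewrite ltnS (ltn_neqAle l m) andbC; congr (_ && _).
have [Z [i [r [NZ ri]]]] := partial n (leqnn n).
apply: (Nr _ Z) => //; exists i, r; rewrite ri -E.
by apply: eq_bigl => k; rewrite ltn_ord.
Qed.

Lemma subcategory_iso (N : set C) X Y :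
  subcategory N -> isomorphic X Y -> N X -> N Y.
Proof. by move=> [Ni _]; apply: Ni. Qed.

Lemma subcategory_zero (N : set C) Z : subcategory N -> zero_object Z -> N Z.
Proof.
move=> [_ Nc] zZ.
(* A zero object is a coproduct of the empty family. *)
apply/(Nc 0%N (fun=> Z) Z (fun k => idc Z)) => [|[]//].
move=> W g; exists 0; split=> [[]//|h _].
by rewrite -[h]compc1 (proj1 (zero_objectP Z) zZ) compr0.
Qed.

Lemma subcategory_biproduct (N : set C) X Y Z (i : hom X Y) p (j : hom Z Y) q :
  subcategory N -> biproduct i p j q -> N Y <-> N X /\ N Z.
Proof.
move=> [_ Nc] /biproduct_is_coproduct/Nc ->; split=> [H|[NX NZ] [[|[|//]] k2] //].
by split; [exact: (H ord0) | exact: (H ord_max)].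
Qed.

End Additive.

Section AdditiveFunctor.
Context (C D : additive_category) (F : functor C D) (FD : additive_functor F).

Lemma fmap0 (X Y : C) : fmap F (0 : hom X Y) = 0.
Proof. by apply: (addrI (fmap F (0 : hom X Y))); rewrite -FD !addr0. Qed.

Lemma fmapN (X Y : C) (f : hom X Y) : fmap F (- f) = - fmap F f.
Proof. by apply: (addrI (fmap F f)); rewrite -FD !subrr fmap0. Qed.

Lemma fmapB (X Y : C) (f g : hom X Y) : fmap F (f - g) = fmap F f - fmap F g.
Proof. by rewrite FD fmapN. Qed.

Lemma fmap_biproduct (X Y Z : C) (i : hom X Y) p (j : hom Z Y) q :
  biproduct i p j q -> biproduct (fmap F i) (fmap F p) (fmap F j) (fmap F q).
Proof.
move=> [pi qj qi pj E].
by split; rewrite -!fmap_comp ?pi ?qj ?qi ?pj -?FD ?E ?fmap_id ?fmap0.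
Qed.

Lemma fmap_zero_object (Z : C) : zero_object Z -> zero_object (F Z).
Proof. by move=> /zero_objectP E; apply/zero_objectP; rewrite -fmap_id E fmap0. Qed.

End AdditiveFunctor.

(** * Triangles *)

Definition tri (T : triangulated_category) (X Y Z : T) : Prop :=
  exists (f : hom X Y) (g : hom Y Z) (h : hom Z (shift T X)), dist f g h.

Section Triangulated.
Context (T : triangulated_category).
Implicit Types X Y Z W : T.

Local Notation "X [1]" := (shift T X) (at level 2, format "X [1]").
Local Notation "f ^[1]" := (fmap (shift T) f) (at level 2, format "f ^[1]").

Lemma shift_full X Y (f : hom X[1] Y[1]) : exists g : hom X Y, g^[1] = f.
Proof. by case: ((shift_autoequivalence T).1 X Y) => g _ gK; exists (g f). Qed.

Lemma shift_inj X Y (f g : hom X Y) : f^[1] = g^[1] -> f = g.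
Proof. by move/(bij_inj ((shift_autoequivalence T).1 X Y)). Qed.

Lemma shift0 X Y : (0 : hom X Y)^[1] = 0.
Proof. exact: (fmap0 (@shift_additive T) X Y). Qed.

Lemma shift_isomorphic X Y : isomorphic X[1] Y[1] <-> isomorphic X Y.
Proof.
split=> [[f [g [fK Kf]]]|]; last exact: fmap_isomorphic.
have [f' f'E] := shift_full f; have [g' g'E] := shift_full g.
by exists f', g'; split; apply: shift_inj; rewrite fmap_comp f'E g'E fmap_id.
Qed.

Lemma shift_retract X Y : retract X[1] Y[1] <-> retract X Y.
Proof.
split=> [[f [g fK]]|]; last exact: fmap_retract.
have [f' f'E] := shift_full f; have [g' g'E] := shift_full g.
by exists f', g'; apply: shift_inj; rewrite fmap_comp f'E g'E fmap_id.
Qed.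

Lemma shift_homzero X Y : homzero X[1] Y[1] <-> homzero X Y.
Proof.
split=> H f; first by apply: shift_inj; rewrite (H f^[1]) shift0.
by have [g <-] := shift_full f; rewrite (H g) shift0.
Qed.

Lemma unshift X : exists Y, isomorphic X Y[1].
Proof.
have [Y /isomorphic_sym i] := (shift_autoequivalence T).2 X; by exists Y.
Qed.

Lemma iter_shift_iso n X Y :
  isomorphic (iter n (shift T) X) (iter n (shift T) Y) <-> isomorphic X Y.
Proof. by elim: n => //= n IH; rewrite shift_isomorphic. Qed.

Lemma iter_shift_homzero n X Y :
  homzero (iter n (shift T) X) (iter n (shift T) Y) <-> homzero X Y.
Proof. by elim: n => //= n IH; rewrite shift_homzero. Qed.

Lemma iter_unshift n X : exists Y, isomorphic X (iter n (shift T) Y).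
Proof.
elim: n => [|n [Y iY]]; first by exists X; apply: isomorphic_refl.
have [Z iZ] := unshift Y; exists Z; rewrite iterSr.
by apply: isomorphic_trans iY _; apply/iter_shift_iso.
Qed.

Lemma zero_object_shift Z : zero_object Z -> zero_object Z[1].
Proof. exact: fmap_zero_object (@shift_additive T) _. Qed.

(** * Exactness of Hom on triangles *)

Section Exact.
Context (X Y Z : T) (f : hom X Y) (g : hom Y Z) (h : hom Z X[1]).
Hypothesis dfgh : dist f g h.

Lemma dist_comp0 : g \oc f = 0.
Proof.
have [Z0 zZ0] := zero_object_exists T.
have [|w [<- _]] := dist_morphism (u := idc X) (v := f) (dist_id X zZ0) dfgh.
  by [].
by rewrite compr0.
Qed.

(** TR3 supplies a morphism of triangles to [0 -> W -> W -> 0], whose third component is the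
    factorization. *)
Lemma weak_cokernel W (k : hom Y W) : k \oc f = 0 -> exists l, l \oc g = k.
Proof.
move=> kf; have [Z0 zZ0] := zero_object_exists T.
have d : dist (0 : hom Z0 W) (idc W) (0 : hom W Z0[1]).
  apply/dist_rotate; rewrite shift0 oppr0.
  exact: dist_id (zero_object_shift zZ0).
have [|l [lg _]] := dist_morphism (u := 0) (v := k) dfgh d.
  by rewrite kf comp0r.
by exists l; rewrite lg comp1c.
Qed.

(** Rotating [W -> W -> 0] puts [W[1]] in third place, where TR3 supplies a morphism to [X[1]];
    fullness and faithfulness of the shift bring it back. *)
Lemma weak_kernel W (k : hom W Y) : g \oc k = 0 -> exists l, f \oc l = k.
Proof.
move=> gk; have [Z0 zZ0] := zero_object_exists T.
have d := dist_id W zZ0; move/dist_rotate in d.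
have /dist_rotate d' := dfgh.
have [|w [_]] := dist_morphism (u := k) (v := 0) d d'.
  by rewrite gk comp0r.
have [l <-] := shift_full w.
rewrite fmap_id compNr compc1 compNl => /oppr_inj; rewrite -fmap_comp => /shift_inj.
by move=> ->; exists l.
Qed.

End Exact.

Lemma dist_comp0r X Y Z (f : hom X Y) (g : hom Y Z) (h : hom Z X[1]) :
  dist f g h -> h \oc g = 0.
Proof. by move=> /dist_rotate/dist_comp0. Qed.

Lemma dist_comp0s X Y Z (f : hom X Y) (g : hom Y Z) (h : hom Z X[1]) :
  dist f g h -> f^[1] \oc h = 0.
Proof.
by move=> /dist_rotate/dist_comp0r/eqP; rewrite compNl oppr_eq0 => /eqP.
Qed.

(** [e - idc Z] kills [g], hence factors through [h], and [h] kills it; so its square is zero and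
    [2 - e] inverts [e]. *)
Lemma dist_endo_iso X Y Z (f : hom X Y) (g : hom Y Z) (h : hom Z X[1]) e :
  dist f g h -> e \oc g = g -> h \oc e = h -> is_iso e.
Proof.
move=> d eg he; have := d; move/dist_rotate => /weak_cokernel.
move=> /(_ _ (e - idc Z)); rewrite compBl eg comp1c subrr => /(_ erefl)[k kh].
have E : e \oc e = e + e - idc Z.
  apply/eqP; rewrite -subr_eq0; apply/eqP.
  have : (e - idc Z) \oc (e - idc Z) = 0.
    by rewrite -{1}kh -compcA compBr he compc1 subrr compr0.
  rewrite compBr !compBl !comp1c !compc1 => <-.
  by rewrite !opprB opprD !addrA; congr (_ - _); rewrite addrAC.
exists (idc Z + idc Z - e).
by rewrite compBl compBr compDl compDr comp1c compc1 E opprB addrC subrK.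
Qed.

(** TR3 gives fill-ins in both directions. They need not be mutually inverse, but their composites
    are invertible by [dist_endo_iso]. *)
Lemma dist_morphism_iso X Y Z X' Y' Z'
    (f : hom X Y) (g : hom Y Z) (h : hom Z X[1])
    (f' : hom X' Y') (g' : hom Y' Z') (h' : hom Z' X'[1])
    (u : hom X X') (v : hom Y Y') :
  dist f g h -> dist f' g' h' -> v \oc f = f' \oc u -> is_iso u -> is_iso v ->
  isomorphic Z Z'.
Proof.
move=> d d' E [u' [uK Ku]] [v' [vK Kv]].
have [w [wg hw]] := dist_morphism d d' E.
have [|w' [wg' hw']] := dist_morphism (u := u') (v := v') d' d.
  by rewrite -[f' in LHS]compc1 -Ku (compcA f') -E compcA compcA vK comp1c.
exists w; apply: (@is_iso_split _ _ _ w w' w').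
- apply: (dist_endo_iso d); first by rewrite -compcA wg compcA wg' -compcA vK compc1.
  by rewrite compcA -hw' -compcA -hw compcA -fmap_comp uK fmap_id comp1c.
- apply: (dist_endo_iso d'); first by rewrite -compcA wg' compcA wg -compcA Kv compc1.
  by rewrite compcA -hw -compcA -hw' compcA -fmap_comp Ku fmap_id comp1c.
Qed.

Lemma tri_iso X Y Z X' Y' Z' :
  isomorphic X X' -> isomorphic Y Y' -> isomorphic Z Z' -> tri X Y Z ->
  tri X' Y' Z'.
Proof.
move=> [u iu] [v iv] [w iw] [f [g [h d]]].
have [u' [uK Ku]] := iu; have [v' [vK Kv]] := iv; have [w' [wK Kw]] := iw.
exists (v \oc f \oc u'), (w \oc g \oc v'), (u^[1] \oc h \oc w').
by apply: (dist_iso iu iv iw _ _ _ d); rewrite -!compcA ?uK ?vK ?wK !compc1.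
Qed.

Lemma tri_rotate X Y Z : tri X Y Z -> tri Y Z X[1].
Proof. by move=> [f [g [h /dist_rotate d]]]; exists g, h, (- f^[1]). Qed.

Lemma tri_rotateV X Y Z : tri Y Z X[1] -> tri X Y Z.
Proof.
move=> [g [h [k d]]]; have [f fE] := shift_full (- k).
by exists f, g, h; apply/dist_rotate; rewrite fE opprK.
Qed.

Lemma tri_shift X Y Z : tri X[1] Y[1] Z[1] <-> tri X Y Z.
Proof. by split=> [/tri_rotateV/tri_rotateV/tri_rotateV|/tri_rotate/tri_rotate/tri_rotate]. Qed.

Lemma tri_iter_shift n X Y Z :
  tri (iter n (shift T) X) (iter n (shift T) Y) (iter n (shift T) Z) <-> tri X Y Z.
Proof. by elim: n => //= n IH; rewrite tri_shift. Qed.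

Lemma dist_cocone Y Z (g : hom Y Z) :
  exists X (f : hom X Y) (h : hom Z X[1]), dist f g h.
Proof.
have [W [h [k d]]] := dist_complete g.
(* The cone is a shift only up to isomorphism, and rotating back costs a sign. *)
have [X [v iv]] := unshift W; have [v' [vK Kv]] := iv.
have [f fE] := shift_full (- (k \oc v')).
exists X, f, (v \oc h); apply/dist_rotate; rewrite fE opprK.
apply: (dist_iso (is_iso_id _) (is_iso_id _) iv _ _ _ d).
- by rewrite comp1c compc1.
- by rewrite compc1.
- by rewrite fmap_id comp1c -compcA vK compc1.
Qed.

Lemma homzero_ext W X Y Z :
  tri X Y Z -> homzero W X -> homzero W Z -> homzero W Y.
Proof.
move=> [f [g [h d]]] zX zZ k.
by have [|l <-] := weak_kernel d (k := k); [exact: zZ | rewrite (zX l) compr0].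
Qed.

Lemma homzero_extl W X Y Z :
  tri X Y Z -> homzero X W -> homzero Z W -> homzero Y W.
Proof.
move=> [f [g [h d]]] zX zZ k.
by have [|l <-] := weak_cokernel d (k := k); [exact: zX | rewrite (zZ l) comp0r].
Qed.

(** With [h = 0] the identity of [Z] lifts to [j], and [idc Y - j \oc g] lifts to [p]; the other
    identities follow because [f] is monic. *)
Lemma dist_split X Y Z (f : hom X Y) (g : hom Y Z) (h : hom Z X[1]) :
  dist f g h -> h = 0 -> exists p j, biproduct f p j g.
Proof.
move=> d h0; have d1 := d; move/dist_rotate in d1.
have [|j gj] := weak_kernel d1 (k := idc Z); first by rewrite h0 comp0r.
have [|p fp] := weak_kernel d (k := idc Y - j \oc g).
  by rewrite compBr compcA gj compc1 comp1c subrr.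
have gf := dist_comp0 d.
have fmono W (k l : hom W X) : f \oc k = f \oc l -> k = l.
  move=> fkl; apply: shift_inj; apply/eqP; rewrite -subr_eq0; apply/eqP.
  have d2 := d1; move/dist_rotate in d2.
  have [|m <-] := weak_kernel d2 (k := k^[1] - l^[1]); last by rewrite h0 comp0r.
  by rewrite compNl compBr -!fmap_comp fkl subrr oppr0.
exists p, j; split=> //; last by rewrite fp subrK.
- by apply: fmono; rewrite compcA fp compBl -compcA gf compr0 subr0 comp1c compc1.
- by apply: fmono; rewrite compcA fp compBl -compcA gj compc1 comp1c subrr compr0.
Qed.

Lemma dist_retraction X Y Z (f : hom X Y) (g : hom Y Z) (h : hom Z X[1]) r :
  dist f g h -> r \oc f = idc X -> h = 0.
Proof.
move=> d rf; have := dist_comp0s d.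
move=> /(congr1 (fun k => r^[1] \oc k)).
by rewrite compcA -fmap_comp rf fmap_id comp1c compr0.
Qed.

(** The cone of the split monomorphism [i] is a complement of [X] in [Y], and so is [Z]; the two
    complements are compared. *)
Lemma biproduct_tri X Y Z (i : hom X Y) p (j : hom Z Y) q :
  biproduct i p j q -> tri X Y Z.
Proof.
move=> [pi qj qi pj E].
have [W [g [h d]]] := dist_complete i.
have [p' [j' [pi' gj' _ pj' E']]] := dist_split d (dist_retraction d pi).
have gi := dist_comp0 d.
suff iW : isomorphic W Z.
  apply: (tri_iso (isomorphic_refl X) (isomorphic_refl Y) iW).
  by exists i, g, h.
exists (q \oc j'), (g \oc j); split.
- have : g \oc (i \oc p + j \oc q) \oc j' = g \oc j' by rewrite E compc1.
  by rewrite compDr compcA gi comp0r add0r gj' !compcA.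
- have : q \oc (i \oc p' + j' \oc g) \oc j = q \oc j by rewrite E' compc1.
  by rewrite compDr compcA qi comp0r add0r qj !compcA.
Qed.

Lemma biproduct_sym X Y Z (i : hom X Y) p (j : hom Z Y) q :
  biproduct i p j q -> biproduct j q i p.
Proof. by move=> [pi qj qi pj E]; split=> //; rewrite addrC. Qed.

Lemma tri_split X Y Z : tri X Y Z -> homzero Z X[1] ->
  exists (f : hom X Y) p j (g : hom Y Z), biproduct f p j g.
Proof.
move=> [f [g [h d]]] /(_ h) h0; have [p [j b]] := dist_split d h0.
by exists f, p, j, g.
Qed.

Lemma tri_swap X Y Z : tri X Y Z -> homzero Z X[1] -> tri Z Y X.
Proof. by move=> t z; have [f [p [j [g /biproduct_sym/biproduct_tri]]]] := tri_split t z. Qed.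

Lemma tri_zerol Z0 X : zero_object Z0 -> tri Z0 X X.
Proof.
move=> zZ0; exists 0, (idc X), 0; apply/dist_rotate; rewrite shift0 oppr0.
exact: dist_id (zero_object_shift zZ0).
Qed.

Lemma tri_zeror Z0 X : zero_object Z0 -> tri X X Z0.
Proof. by move=> zZ0; exists (idc X), 0, 0; apply: dist_id. Qed.

Lemma octahedron X Y Z A B :
  tri X Y A -> tri Y Z B -> exists C, tri X Z C /\ tri A C B.
Proof.
move=> [f [f1 [f2 df]]] [g [g1 [g2 dg]]].
have [C [h1 [h2 dh]]] := dist_complete (g \oc f).
have [u [v [duv _ _ _ _]]] := dist_octahedron df dg dh.
by exists C; split; [exists (g \oc f), h1, h2 | exists u, v, (f1^[1] \oc g2)].
Qed.

(** The octahedral axiom for the composite [C -> B -> B2], whose fibre is [L]. *)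
Lemma octahedronV (A C B B1 B2 : T) :
  tri A C B -> tri B1 B B2 -> exists L, tri A L B1 /\ tri L C B2.
Proof.
move=> /tri_rotate t1 /tri_rotate t2.
have [K [tK tK']] := octahedron t1 t2; have [L iL] := unshift K.
exists L; split; first by apply/tri_shift; apply: tri_iso tK' => //; apply: isomorphic_refl.
by apply: tri_rotateV; apply: tri_iso tK => //; apply: isomorphic_refl.
Qed.

(** The usual extension product [N * P]. *)
Definition star (N P : set T) : set T :=
  [set C | exists A B, [/\ N A, P B & tri A C B]].

Definition iso_closed (N : set T) : Prop :=
  forall X Y, isomorphic X Y -> N X -> N Y.

Definition ext_closed (N : set T) : Prop :=
  forall X Y Z, tri X Y Z -> N X -> N Z -> N Y.

Lemma star_iso N P : iso_closed (star N P).
Proof.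
move=> X Y iXY [A [B [NA PB t]]]; exists A, B; split=> //.
by apply: tri_iso t => //; apply: isomorphic_refl.
Qed.

(* Iyama-Yoshino: [N * P * N * P] is contained in [N * N * P * P], because the
   middle triangle splits. *)
Lemma star_ext N P : ext_closed N -> ext_closed P ->
  (forall X Y, N X -> P Y -> homzero X Y[1]) -> ext_closed (star N P).
Proof.
move=> Ne Pe NP C1 C2 C3 t [A1 [B1 [NA1 PB1 t1]]] [A3 [B3 [NA3 PB3 t3]]].
have [K [tA1 tB1]] := octahedron t1 t.
have [L [tL tL']] := octahedronV tB1 t3.
have [M [tM tM']] := octahedron (tri_swap tL (NP _ _ NA3 PB1)) tL'.
have [O [tO tO']] := octahedronV tA1 tM.
by exists O, M; split; [apply: Ne tO _ _ | apply: Pe tM' _ _ |].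
Qed.

Lemma star_assoc N P Q : star (star N P) Q = star N (star P Q).
Proof.
apply/seteqP; split=> C.
- move=> [A [B [[A1 [A2 [NA1 PA2 t1]]] QB t]]].
  by have [K [tK tK']] := octahedron t1 t; exists A1, K; split=> //; exists A2, B.
- move=> [A [B [NA [B1 [B2 [PB1 QB2 t1]]] t]]].
  by have [L [tL tL']] := octahedronV t t1; exists L, B2; split=> //; exists A, B1.
Qed.

Lemma thick_intro (N : set T) :
  (forall Z, zero_object Z -> N Z) ->
  (forall X Y, retract X Y -> N Y -> N X) ->
  (forall X, N X <-> N X[1]) ->
  ext_closed N -> thick N.
Proof.
move=> N0 Nr Ns Ne; split=> //.
- apply: subcategory_intro => // X Z NX NZ.
  have [Y [i [p [j [q b]]]]] := biproduct_exists X Z.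
  by exists Y, i, p, j, q; split=> //; apply: Ne (biproduct_tri b) _ _.
- move=> X Y Z f g h d NX NY; apply: (Ne Y Z X[1] _ NY); last by apply/(Ns X).
  by apply: tri_rotate; exists f, g, h.
Qed.

(** In a triangulated category every split monomorphism has a complement, namely its cone, so
    retracts are direct summands. *)
Lemma subcategory_retract (N : set T) X Y : subcategory N -> retract X Y -> N Y -> N X.
Proof.
move=> Ns [i [r ri]] NY; have [Z [g [h d]]] := dist_complete i.
have [p [j b]] := dist_split d (dist_retraction d ri).
by have [/(_ NY)[]] := subcategory_biproduct Ns b.
Qed.

(** * Thick subcategories *)

Section Thick.
Context (N : set T) (Nt : thick N).

Lemma thick_sub : subcategory N. Proof. by case: Nt. Qed.

Lemma thick_shift X : N X <-> N X[1]. Proof. by case: Nt. Qed.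

Lemma thick_cone X Y Z : tri X Y Z -> N X -> N Y -> N Z.
Proof. by move=> [f [g [h d]]]; case: Nt => _ _; apply; exact: d. Qed.

Lemma thick_ext : ext_closed N.
Proof.
move=> X Y Z /tri_rotate/tri_rotate t NX NZ; apply/thick_shift.
by apply: (thick_cone t) => //; apply/(thick_shift X).
Qed.

Lemma thick_fiber X Y Z : tri X Y Z -> N Y -> N Z -> N X.
Proof. by move=> /tri_rotate t NY NZ; apply/thick_shift; apply: (thick_cone t). Qed.

Lemma thick_iso : iso_closed N.
Proof. by move=> X Y; apply: subcategory_iso thick_sub. Qed.

Lemma thick_retract X Y : retract X Y -> N Y -> N X.
Proof. exact: subcategory_retract thick_sub. Qed.

Lemma thick_zero Z : zero_object Z -> N Z.
Proof. exact: subcategory_zero thick_sub. Qed.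

Lemma thick_iter_shift n X : N X <-> N (iter n (shift T) X).
Proof. by elim: n => //= n ->; apply: thick_shift. Qed.

End Thick.

Lemma thickI (N P : set T) : thick N -> thick P -> thick (N `&` P).
Proof.
move=> Nt Pt; apply: thick_intro.
- by move=> Z zZ; split; apply: thick_zero.
- by move=> X Y r [NY PY]; split; apply: thick_retract r _.
- by move=> X; split=> -[NX PX]; split; apply/(thick_shift _ X).
- by move=> X Y Z t [NX PX] [NZ PZ]; split; apply: thick_ext t _ _.
Qed.

(** Induction principle for the objects generated by a silting subcategory. The definition of [silt]
    tests thick subcategories inside [V], hence the intersection. *)
Lemma silt_sub (V M N : set T) : silt V M -> thick V -> thick N -> M `<=` N -> V `<=` N.
Proof.
move=> [_ MV _ E] Vt Nt MN X; rewrite -E => /(_ (N `&` V)); case=> //; split.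
- by split; [apply: thickI | move=> ? []].
- by move=> Y MY; split; [apply: MN | apply: MV].
Qed.

End Triangulated.

(** * Roofs *)

Lemma sval_inj (A : Type) (P : A -> Prop) (x y : {a | P a}) :
  sval x = sval y -> x = y.
Proof.
by case: x y => [x Px] [y Py] /= E; case: _ / E in Py *; rewrite (Prop_irrelevance Px Py).
Qed.

Definition cone_in (T : triangulated_category) (S : set T) (X Y : T)
    (f : hom X Y) : Prop :=
  exists (Z : T) (g : hom Y Z) (h : hom Z (shift T X)), dist f g h /\ S Z.

Section Roofs.
Context (T : triangulated_category) (S : set T) (S_thick : thick S).
Local Notation W := (cone_in S).

Lemma cone_in_dist (X Y Z : T) (f : hom X Y) (g : hom Y Z) (h : hom Z (shift T X)) :
  W f -> dist f g h -> S Z.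
Proof.
move=> [Z' [g' [h' [d' SZ']]]] d; apply: (thick_iso S_thick) SZ'.
apply: (dist_morphism_iso d' d) (is_iso_id _) (is_iso_id _).
by rewrite comp1c compc1.
Qed.

Lemma cone_in_iso (X Y : T) (f : hom X Y) : is_iso f -> W f.
Proof.
move=> fi; have [Z zZ] := zero_object_exists T; have [f' [fK Kf]] := fi.
exists Z, 0, 0; split; last exact: (thick_zero S_thick).
apply: (dist_iso (is_iso_id X) fi (is_iso_id Z) _ _ _ (dist_id X zZ)).
- by [].
- by rewrite compr0 comp0r.
- by rewrite compr0 comp0r.
Qed.

Lemma cone_in_comp (X Y Z : T) (g : hom Y Z) (f : hom X Y) :
  W g -> W f -> W (g \oc f).
Proof.
move=> [B [g1 [g2 [dg SB]]]] [A [f1 [f2 [df SA]]]].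
have [C [h1 [h2 dh]]] := dist_complete (g \oc f).
have [u [v [duv _ _ _ _]]] := dist_octahedron df dg dh.
exists C, h1, h2; split=> //; apply: (thick_ext S_thick) SA SB.
by exists u, v, (fmap (shift T) f1 \oc g2).
Qed.

(** [X'] is the fibre of [X -> Y -> C], where [C] is the cone of [t]; thus [t'] has the same
    cone. *)
Lemma cone_in_ore (X Y Y' : T) (f : hom X Y) (t : hom Y' Y) : W t ->
  exists (X' : T) (t' : hom X' X) (f' : hom X' Y'), W t' /\ f \oc t' = t \oc f'.
Proof.
move=> [C [c [h [d SC]]]].
have [X' [t' [k d']]] := dist_cocone (c \oc f).
have [|f' f'E] := weak_kernel d (k := f \oc t').
  by rewrite compcA (dist_comp0 d').
by exists X', t', f'; split=> //; exists C, (c \oc f), k.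
Qed.

(** [f] factors through the fibre [K] of [s], an object of [S]; the fibre [u] of [X -> K] then has
    cone [K], and [f \oc u = 0]. *)
Lemma cone_in_cancel0 (X Y Z : T) (f : hom X Y) (s : hom Y Z) : W s ->
  s \oc f = 0 -> exists (X' : T) (u : hom X' X), W u /\ f \oc u = 0.
Proof.
move=> Ws sf; have [K [j [h d]]] := dist_cocone s.
have SK : S K.
  by apply/(thick_shift S_thick); apply: cone_in_dist Ws _; move/dist_rotate: d; apply.
have [l lf] := weak_kernel d sf.
have [X' [u [k du]]] := dist_cocone l.
exists X', u; split; first by exists K, l, k.
by rewrite -lf -compcA (dist_comp0 du) compr0.
Qed.

Lemma cone_in_cancel (X Y Z : T) (f g : hom X Y) (s : hom Y Z) : W s ->
  s \oc f = s \oc g -> exists (X' : T) (u : hom X' X), W u /\ f \oc u = g \oc u.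
Proof.
move=> Ws E; have [|X' [u [Wu]]] := cone_in_cancel0 (f := f - g) Ws.
  by rewrite compBr E subrr.
by rewrite compBl => /eqP; rewrite subr_eq0 => /eqP fu; exists X', u.
Qed.

(* Pulling back saturated families of spans is strictly functorial and turns the
   morphisms with cone in [S] into bijections, so morphisms of the quotient can be
   modelled by functions between such families. *)
Definition saturated (X : T) (P : forall V Z : T, hom Z V -> hom Z X -> Prop) :=
  (forall (V Z Z' : T) (a : hom Z V) (g : hom Z X) (r : hom Z' Z),
     P V Z a g -> P V Z' (a \oc r) (g \oc r)) /\
  (forall (V Z Z' : T) (a : hom Z V) (g : hom Z X) (w : hom Z' Z),
     W w -> P V Z' (a \oc w) (g \oc w) -> P V Z a g).

Definition families (X : T) := {P | @saturated X P}.

Lemma family_eq (X : T) (P P' : families X) :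
  (forall V Z a g, sval P V Z a g <-> sval P' V Z a g) -> P = P'.
Proof.
move=> E; apply: sval_inj; do 4!apply: functional_extensionality_dep => ?.
exact/propext.
Qed.

Lemma pullback_subproof (X Y : T) (f : hom X Y) (P : families Y) :
  @saturated X (fun V Z a g => sval P V Z a (f \oc g)).
Proof.
have [P1 P2] := svalP P.
split=> V Z Z' a g w; rewrite compcA; [exact: P1 | exact: P2].
Qed.

Definition pullback (X Y : T) (f : hom X Y) (P : families Y) : families X :=
  exist _ _ (pullback_subproof f P).

Lemma pullback_id (X : T) (P : families X) : pullback (idc X) P = P.
Proof. by apply: family_eq => V Z a g /=; rewrite comp1c. Qed.

Lemma pullback_comp (X Y Z : T) (g : hom Y Z) (f : hom X Y) (P : families Z) :
  pullback (g \oc f) P = pullback f (pullback g P).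
Proof. by apply: family_eq => V V' a h /=; rewrite compcA. Qed.

Lemma pullback_inj (X Y : T) (s : hom X Y) : W s -> injective (pullback s).
Proof.
move=> Ws.
suff le (P P' : families Y) : pullback s P = pullback s P' ->
    forall V Z a g, sval P V Z a g -> sval P' V Z a g.
  by move=> P P' E; apply: family_eq => V Z a g; split; apply: le.
move=> E V Z a g Pg.
have [Z' [w [g' [Ww gw]]]] := cone_in_ore g Ws.
apply: (svalP P').2 Ww _; rewrite gw.
suff: sval (pullback s P) V Z' (a \oc w) g' by rewrite E.
by rewrite /= -gw; apply: (svalP P).1.
Qed.

Lemma pullback_surj (X Y : T) (s : hom X Y) (P : families X) : W s ->
  exists P', pullback s P' = P.
Proof.
move=> Ws; have [P1 P2] := svalP P.
(* A span belongs to [P'] when some refinement of it factors through [s] by a member of [P]. *)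
pose P' (V Z : T) (a : hom Z V) (g : hom Z Y) :=
  exists (Z' : T) (w : hom Z' Z) (g' : hom Z' X),
    [/\ W w, g \oc w = s \oc g' & sval P V Z' (a \oc w) g'].
have P's : saturated P'.
  split=> V Z Z' a g w => [[Z1 [w1 [g1 [Ww1 gw1 Pg1]]]]|Ww [Z1 [w1 [g1 [Ww1 gw1 Pg1]]]]].
    have [Z2 [t [r [Wt wt]]]] := cone_in_ore w Ww1.
    exists Z2, t, (g1 \oc r); split=> //.
      by rewrite -compcA wt compcA gw1 compcA.
    by rewrite -compcA wt compcA; apply: P1.
  exists Z1, (w \oc w1), g1; split; first exact: cone_in_comp.
    by rewrite compcA.
  by rewrite compcA.
exists (exist _ P' P's); apply: family_eq => V Z a g /=; split=> [[Z1 [w [g1 [Ww]]]]|Pg].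
  rewrite -compcA => /(cone_in_cancel Ws)[Z2 [u [Wu gu]]] Pg1.
  have := P1 _ _ _ _ _ u Pg1.
  by rewrite -gu -!compcA; apply: P2; apply: cone_in_comp.
exists Z, (idc Z), g; rewrite !compc1; split=> //.
exact: cone_in_iso (is_iso_id Z).
Qed.

Lemma pullback_faithful (X Y : T) (f g : hom X Y) : pullback f = pullback g ->
  exists (X' : T) (u : hom X' X), W u /\ f \oc u = g \oc u.
Proof.
move=> fg.
(* Spans over [V = X] in which [h] equals [f \oc a] up to refinement. The pullback by [f] contains
   the pair of identities, so the pullback by [g] does too, and this compares [g] with [f]. *)
pose P (V Z : T) (a : hom Z V) (h : hom Z Y) :=
  exists e : V = X, let a' := match e in _ = X' return hom Z X' with erefl => a end in
  exists (Z' : T) (w : hom Z' Z), W w /\ h \oc w = f \oc a' \oc w.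
have Ps : saturated P.
  split=> V Z Z' a h w => [[e]|Ww [e]]; case: _ / e in f g fg P *.
    move=> [Z1 [w1 [Ww1 hw1]]]; exists erefl => /=.
    have [Z2 [t [r [Wt wt]]]] := cone_in_ore w Ww1.
    exists Z2, t; split=> //.
    by rewrite -compcA wt compcA hw1 -!compcA wt.
  move=> [Z1 [w1 [Ww1 hw1]]]; exists erefl => /=.
  exists Z1, (w \oc w1); split; first exact: cone_in_comp.
  by rewrite compcA hw1 -!compcA.
have : sval (pullback f (exist _ P Ps)) X X (idc X) (idc X).
  exists erefl, X, (idc X); split; first exact: cone_in_iso (is_iso_id X).
  by [].
rewrite fg => -[e]; rewrite (Prop_irrelevance e erefl) /= !compc1.
by move=> [X' [u [Wu gu]]]; exists X', u.
Qed.

(** Pullback is contravariant and [pullback s] is bijective, so [phi] stands for the fraction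
    [f \oc s^-1] from [X] to [Y]. *)
Definition roof (X Y : T) (phi : families Y -> families X) : Prop :=
  exists (X' : T) (s : hom X' X) (f : hom X' Y),
    W s /\ pullback s \o phi = pullback f.

Lemma roof_pullback (X Y : T) (f : hom X Y) : roof (pullback f).
Proof.
exists X, (idc X), f; split; first exact: cone_in_iso (is_iso_id X).
by apply/funext => P /=; rewrite pullback_id.
Qed.

Lemma roof_id (X : T) : roof (@id (families X)).
Proof.
rewrite (_ : id = pullback (idc X)); first exact: roof_pullback.
by apply/funext => P; rewrite pullback_id.
Qed.

Lemma roof_comp (X Y Z : T) (psi : families Z -> families Y)
    (phi : families Y -> families X) : roof psi -> roof phi -> roof (phi \o psi).
Proof.
move=> [Y' [t [g [Wt tg]]]] [X' [s [f [Ws sf]]]].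
have [X2 [t' [f' [Wt' E]]]] := cone_in_ore f Wt.
exists X2, (s \oc t'), (g \oc f'); split; first exact: cone_in_comp.
apply/funext => P /=; rewrite !pullback_comp.
have -> : pullback s (phi (psi P)) = pullback f (psi P) by rewrite -sf.
by rewrite -pullback_comp E pullback_comp -tg.
Qed.

Definition roof_hom (X Y : T) := {phi | @roof X Y phi}.

Definition roof_category : category.
Proof.
refine (@Category T roof_hom
  (fun X => exist _ _ (roof_id X))
  (fun X Y Z psi phi => exist _ _ (roof_comp (svalP psi) (svalP phi))) _ _ _).
- by move=> X Y [phi r]; apply: sval_inj.
- by move=> X Y [phi r]; apply: sval_inj.
- by move=> X Y Z V [xi rx] [psi rp] [phi r]; apply: sval_inj.
Defined.

Definition roof_functor : functor T roof_category.
Proof.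
refine (@Functor T roof_category (fun X => X)
  (fun X Y f => exist _ _ (roof_pullback f)) _ _).
- by move=> X; apply: sval_inj; apply/funext => P; apply: pullback_id.
- by move=> X Y Z g f; apply: sval_inj; apply/funext => P; apply: pullback_comp.
Defined.

Lemma roof_functor_iso (X Y : T) (s : hom X Y) : W s -> is_iso (fmap roof_functor s).
Proof.
move=> Ws; pose inv P := sval (cid (pullback_surj P Ws)).
have invK P : pullback s (inv P) = P by have := svalP (cid (pullback_surj P Ws)).
have ri : roof inv.
  exists X, s, (idc X); split=> //; apply/funext => P /=.
  by rewrite invK pullback_id.
exists (exist _ inv ri : @hom roof_category Y X); split; apply: sval_inj; apply/funext => P /=.
  by rewrite invK.
by apply: (pullback_inj Ws); rewrite invK.
Qed.

Lemma roof_homP (X Y : T) (phi : roof_hom X Y) :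
  exists (X' : T) (s : hom X' X) (f : hom X' Y),
    W s /\ (phi : @hom roof_category X Y) \oc fmap roof_functor s = fmap roof_functor f.
Proof.
by have [X' [s [f [Ws E]]]] := svalP phi; exists X', s, f; split=> //; apply: sval_inj.
Qed.

Lemma roof_functor_faithful (X Y : T) (f g : hom X Y) :
  fmap roof_functor f = fmap roof_functor g ->
  exists (X' : T) (u : hom X' X), W u /\ f \oc u = g \oc u.
Proof. by move=> /(congr1 sval) /= /pullback_faithful. Qed.

End Roofs.

(** * The Verdier quotient *)

Section Extension.
Context (T : triangulated_category) (S : set T) (S_thick : thick S).
Context (U : category) (F : functor T U).
Hypothesis F_iso : forall (X Y : T) (f : hom X Y), cone_in S f -> is_iso (fmap F f).
Local Notation Q := (roof_category S_thick).
Local Notation R := (roof_functor S_thick).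

(** The value on a fraction is [fmap F f] times the inverse of [fmap F s]. Quantifying over all
    representations makes independence of the fraction part of the specification of [k]. *)
Lemma roof_lift (X Y : T) (phi : @hom Q X Y) :
  exists k : hom (F X) (F Y), forall (X' : T) (s : hom X' X) (f : hom X' Y),
    phi \oc fmap R s = fmap R f -> k \oc fmap F s = fmap F f.
Proof.
have [X' [s [f [Ws sf]]]] := roof_homP S_thick phi; have [s' [sK Ks]] := F_iso Ws.
exists (fmap F f \oc s') => X2 t g tg.
(* Both fractions are refined to a common denominator; a further refinement [u] turns their equality
   in the roof category into one in [T]. *)
have [X3 [w [r [Ww wr]]]] := cone_in_ore t Ws.
have [|X4 [u [Wu gu]]] := @roof_functor_faithful _ _ S_thick _ _ (f \oc r) (g \oc w).
  by rewrite !fmap_comp -sf -tg -!compcA -!fmap_comp wr.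
have [v [_ Kv]] := F_iso (cone_in_comp S_thick Ww Wu).
rewrite -[LHS]compc1 -[RHS]compc1 -Kv !compcA; congr (_ \oc v).
rewrite -[RHS]fmap_comp -compcA -fmap_comp !compcA -gu wr.
by rewrite !fmap_comp -!compcA (compcA s') sK comp1c.
Qed.

Definition roof_map (X Y : T) (phi : @hom Q X Y) : hom (F X) (F Y) :=
  sval (cid (roof_lift phi)).

Lemma roof_mapP (X Y X' : T) (phi : @hom Q X Y) (s : hom X' X) (f : hom X' Y) :
  phi \oc fmap R s = fmap R f -> roof_map phi \oc fmap F s = fmap F f.
Proof. exact: (svalP (cid (roof_lift phi))). Qed.

Lemma roof_map_unique (X Y X' : T) (phi : @hom Q X Y) (l : hom (F X) (F Y))
    (s : hom X' X) (f : hom X' Y) :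
  cone_in S s -> phi \oc fmap R s = fmap R f -> l \oc fmap F s = fmap F f ->
  roof_map phi = l.
Proof.
move=> Ws sf lsf; have [v [_ Kv]] := F_iso Ws.
by rewrite -[LHS]compc1 -[RHS]compc1 -Kv !compcA lsf (roof_mapP sf).
Qed.

Lemma roof_map_fmap (X Y : T) (f : hom X Y) : roof_map (fmap R f) = fmap F f.
Proof.
apply: (@roof_map_unique _ _ _ _ _ (idc X) f); last by rewrite fmap_id compc1.
- exact: cone_in_iso (is_iso_id X).
- by rewrite fmap_id compc1.
Qed.

Lemma roof_map_id (X : Q) : roof_map (idc X) = idc (F X).
Proof. by rewrite -fmap_id -roof_map_fmap fmap_id. Qed.

Lemma roof_map_comp (X Y Z : Q) (psi : hom Y Z) (phi : hom X Y) :
  roof_map (psi \oc phi) = roof_map psi \oc roof_map phi.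
Proof.
have [Y' [t [g [Wt tg]]]] := roof_homP S_thick psi.
have [X' [s [f [Ws sf]]]] := roof_homP S_thick phi.
have [X2 [t' [f' [Wt' E]]]] := cone_in_ore f Wt.
apply: (@roof_map_unique _ _ _ _ _ (s \oc t') (g \oc f')).
- exact: cone_in_comp.
- rewrite !fmap_comp !compcA -(compcA psi) sf -compcA -(fmap_comp _ f t') E.
  by rewrite fmap_comp compcA tg.
- rewrite !fmap_comp !compcA -(compcA (roof_map psi)) (roof_mapP sf) -compcA.
  by rewrite -(fmap_comp _ f t') E fmap_comp compcA (roof_mapP tg).
Qed.

Definition roof_extension : functor Q U := Functor roof_map_id roof_map_comp.

End Extension.

Definition functor_id (C : category) : functor C C.
Proof. by refine (@Functor C C (fun X => X) (fun X Y f => f) _ _). Defined.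

Section Quotient.
Context (T U : triangulated_category) (S : set T) (F : triangle_functor T U).
Hypotheses (S_thick : thick S) (F_quotient : verdier_quotient S F).
Local Notation Q := (roof_category S_thick).
Local Notation R := (roof_functor S_thick).

Lemma quotient_iso (X Y : T) (f : hom X Y) : cone_in S f -> is_iso (fmap F f).
Proof. by have [+ _ _] := F_quotient; apply. Qed.

Local Notation K := (roof_extension S_thick quotient_iso).

(* [H] comes from the universal property of [U]; [K \o H] is isomorphic to the identity
   because both extend [F] along [F]. *)
Lemma quotient_section : exists (H : functor U Q) (a : forall X, hom (R X) (H (F X)))
    (b : forall Z : U, hom (K (H Z)) Z),
  [/\ natural (H := functor_comp H F) a, forall X, is_iso (a X),
      natural (G := functor_comp K H) (H := functor_id U) b,
      forall Z, is_iso (b Z)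
    & forall X : T, b (F X) \oc fmap K (a X) = idc (F X)].
Proof.
have [_ /(_ Q R (@roof_functor_iso _ _ S_thick))[H [a [an ai]]] uni] := F_quotient.
pose a' X := sval (cid (ai X)).
have a'K X : a' X \oc a X = idc _ by have [] := svalP (cid (ai X)).
have aK' X : a X \oc a' X = idc _ by have [] := svalP (cid (ai X)).
have KaN X Y (f : hom X Y) :
    fmap K (a Y) \oc fmap F f = fmap K (fmap H (fmap F f)) \oc fmap K (a X).
  have /(congr1 (@fmap _ _ K _ _)) := an _ _ f.
  by rewrite !fmap_comp /= roof_map_fmap.
have Ka'K X : fmap K (a' X) \oc fmap K (a X) = idc (F X).
  by rewrite -fmap_comp a'K fmap_id.
have KaK' X : fmap K (a X) \oc fmap K (a' X) = idc (K (H (F X))).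
  by rewrite -fmap_comp aK' fmap_id.
have [|b [[bn bE] _]] := uni U (functor_comp K H) (functor_id U) (fun X => fmap K (a' X)).
  move=> X Y f /=; rewrite -[LHS]compc1 -(KaK' X) compcA -(compcA (fmap K (a' Y))) -KaN.
  by rewrite compcA Ka'K comp1c.
have [|c [[cn cE] _]] := uni U (functor_id U) (functor_comp K H) (fun X => fmap K (a X)).
  exact: KaN.
have natural_id (G : functor U U) : natural (G := G) (H := G) (fun X => idc (G X)).
  by move=> X Y f; rewrite comp1c compc1.
(* By uniqueness of extensions along [F], a natural endomorphism that is the identity on all [F X]
   is the identity. *)
have unique_id (G : functor U U) (e : forall Z, hom (G Z) (G Z)) :
    natural (G := G) (H := G) e -> (forall X, e (F X) = idc (G (F X))) ->
    forall Z, e Z = idc (G Z).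
  move=> en eE Z; have [|d [_ du]] := uni U G G (fun X => idc (G (F X))).
    by move=> X Y f; apply: natural_id.
  have <- : d = e by apply: du.
  by have -> : d = (fun X => idc (G X)) by apply: du; split.
exists H, a, b; split=> // [Z|X]; last by rewrite bE.
exists (c Z); split.
- apply: (unique_id (functor_comp K H) (fun Z => c Z \oc b Z)) => [X Y f|X].
    by rewrite -compcA bn !compcA; congr (_ \oc _); apply: cn.
  by rewrite bE cE; apply: KaK'.
- apply: (unique_id (functor_id U) (fun Z => b Z \oc c Z)) => [X Y f|X].
    by rewrite -compcA cn !compcA; congr (_ \oc _); apply: bn.
  by rewrite bE cE; apply: Ka'K.
Qed.

Lemma quotient_ess_surj (Z : U) : exists X : T, isomorphic (F X) Z.
Proof.
have [H [a [b [_ _ _ bi _]]]] := quotient_section.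
by exists (H Z), (b Z); exact: bi.
Qed.

Lemma quotient_roof (X Y : T) (phi : hom (F X) (F Y)) :
  exists (X' : T) (s : hom X' X) (f : hom X' Y),
    cone_in S s /\ phi \oc fmap F s = fmap F f.
Proof.
have [H [a [b [an ai bn _ bE]]]] := quotient_section.
have [a' [a'K aK']] := ai Y.
(* [phi] is carried to the roof category by [H] and conjugated by [a], so that [K] sends it back to
   [phi]. *)
pose psi : @hom Q X Y := a' \oc fmap H phi \oc a X.
have psiE : fmap K psi = phi.
  have E : fmap K (a Y) \oc fmap K psi = fmap K (fmap H phi) \oc fmap K (a X).
    by rewrite -!fmap_comp /psi !compcA aK' comp1c.
  rewrite -[LHS]comp1c -(bE Y) -compcA E compcA.
  have := bn _ _ phi; rewrite /= => ->.
  by rewrite -compcA bE compc1.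
have [X' [s [f [Ws sf]]]] := roof_homP S_thick psi.
by exists X', s, f; split=> //; rewrite -psiE; apply: roof_mapP.
Qed.

(** [fmap R h] is recovered from [fmap F h] by applying [H] and conjugating by [a], which reduces
    the claim to the roof category. *)
Lemma quotient_faithful (X Y : T) (f g : hom X Y) : fmap F f = fmap F g ->
  exists (X' : T) (u : hom X' X), cone_in S u /\ f \oc u = g \oc u.
Proof.
have [H [a [_ [an ai _ _ _]]]] := quotient_section.
move=> fg; apply: (@roof_functor_faithful _ _ S_thick).
have [a' [a'K _]] := ai Y.
have E h : fmap R h = a' \oc fmap H (fmap F h) \oc a X.
  by rewrite -compcA -(an _ _ h) compcA a'K comp1c.
by rewrite !E fg.
Qed.

End Quotient.

(** * Approximations and triangle functors *)

Lemma zero_object_isomorphic (C : additive_category) (X Y : C) :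
  isomorphic X Y -> zero_object X -> zero_object Y.
Proof.
move=> [f [g [_ fg]]] /zero_objectP X0; apply/zero_objectP.
by rewrite -fg -[f]compc1 X0 compr0 comp0r.
Qed.

Section MoreTriangles.
Context (T : triangulated_category).
Implicit Types X Y Z V : T.

Lemma dist_iso_zero X Y Z (f : hom X Y) (g : hom Y Z) (h : hom Z (shift T X)) :
  dist f g h -> is_iso f -> zero_object Z.
Proof.
move=> d fi; have [f' [_ ff']] := fi.
have g0 : g = 0 by rewrite -[g]compc1 -ff' compcA (dist_comp0 d) comp0r.
have h0 : h = 0.
  have [k [kf _]] := fmap_iso (shift T) fi.
  by rewrite -[h]comp1c -kf -compcA (dist_comp0s d) compr0.
apply/zero_objectP; have /dist_rotate d' := d.
have [|k <-] := weak_kernel d' (k := idc Z); first by rewrite h0 comp0r.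
by rewrite g0 comp0r.
Qed.

(** The composite [Z -> V[1]] is the obstruction to extending [k] over [Y]. *)
Lemma weak_extension X Y Z V (f : hom X Y) (g : hom Y Z) (h : hom Z (shift T X))
    (k : hom X V) :
  dist f g h -> fmap (shift T) k \oc h = 0 -> exists l : hom Y V, l \oc f = k.
Proof.
move=> /dist_rotate/dist_rotate d /(weak_cokernel d)[m mE].
have [l lE] := shift_full (- m); exists l; apply: shift_inj.
by rewrite fmap_comp lE compNl -compNr.
Qed.

Lemma iter_shift_retract n X Y :
  retract (iter n (shift T) X) (iter n (shift T) Y) <-> retract X Y.
Proof. by elim: n => //= n IH; rewrite shift_retract. Qed.

(** Every test object in [S] is, up to isomorphism, a shift of an object of [S], so the lifting can
    be done before shifting. *)
Lemma right_approximation_iter (S : set T) n X Y (f : hom X Y) :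
  thick S -> right_approximation S f ->
  exists g : hom (iter n (shift T) X) (iter n (shift T) Y), right_approximation S g.
Proof.
move=> St fa; elim: n => [|n [g [SX gP]]]; first by exists f.
exists (fmap (shift T) g); split=> [|X' SX' h]; first exact: (thick_shift St _).1.
have [Z iZ] := unshift X'; have [v [v' [_ vv']]] := isomorphic_sym iZ.
have SZ : S Z by apply: (thick_shift St _).2; apply: (thick_iso St) iZ SX'.
have [k kE] := shift_full (h \oc v); have [l lE] := gP _ SZ k.
exists (fmap (shift T) l \oc v').
by rewrite compcA -fmap_comp lE kE -compcA vv' compc1.
Qed.

End MoreTriangles.

Section TriangleFunctor.
Context (T U : triangulated_category) (F : triangle_functor T U).

Lemma tf_tri (X Y Z : T) : tri X Y Z -> tri (F X) (F Y) (F Z).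
Proof.
move=> [f [g [h d]]].
by exists (fmap F f), (fmap F g), (tf_shift F X \oc fmap F h); apply: tf_dist.
Qed.

Lemma tf_shift_isomorphic (X : T) : isomorphic (F (shift T X)) (shift U (F X)).
Proof. by exists (tf_shift F X); apply: tf_shift_iso. Qed.

Lemma tf_iter_shift n (X : T) :
  isomorphic (F (iter n (shift T) X)) (iter n (shift U) (F X)).
Proof.
elim: n => [|n IH] /=; first exact: isomorphic_refl.
by apply: isomorphic_trans (tf_shift_isomorphic _) _; apply: fmap_isomorphic.
Qed.

Lemma tf_preimage_thick (N : set U) : thick N -> thick [set X | N (F X)].
Proof.
move=> Nt; apply: thick_intro => /=.
- by move=> Z zZ; apply: (thick_zero Nt); exact (fmap_zero_object (@tf_additive _ _ F) zZ).
- by move=> X Y /(fmap_retract F); apply: thick_retract.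
- move=> X; rewrite (thick_shift Nt (F X)); split; apply: (thick_iso Nt).
  + exact/isomorphic_sym/tf_shift_isomorphic.
  + exact: tf_shift_isomorphic.
- by move=> X Y Z /tf_tri; apply: thick_ext.
Qed.

Lemma image_subcategory_sub (M : set T) : subcategory (image_subcategory F M).
Proof.
split=> [X Y iXY MX N [Ns FN]|n Y X inj cX].
  by apply: (subcategory_iso Ns iXY); apply: MX.
split=> [MX k N [Ns FN]|MY N [Ns FN]].
  by apply/(Ns.2 _ _ _ _ cX).1; apply: MX.
by apply/(Ns.2 _ _ _ _ cX).2 => k; apply: MY.
Qed.

Lemma image_subcategory_mem (M : set T) (X : T) : M X -> image_subcategory F M (F X).
Proof. by move=> MX N [_ FN]; apply: FN; exists X. Qed.

(** The retracts of objects [F X] with [X] in [M] already form a subcategory: a biproduct of two of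
    them is a retract of the image of a biproduct in [M]. *)
Lemma image_subcategory_retract (M : set T) (Z : U) : subcategory M ->
  image_subcategory F M Z -> exists2 X, M X & retract Z (F X).
Proof.
move=> Ms /(_ [set Z | exists2 X, M X & retract Z (F X)]); apply.
split=> [|_ [X MX <-]]; last by exists X => //; apply: retract_refl.
apply: subcategory_intro.
- move=> Z0 zZ0; have [X zX] := zero_object_exists T.
  by exists X; [apply: subcategory_zero | apply: zero_object_retract].
- by move=> X Y rXY [V MV rYV]; exists V => //; apply: retract_trans rXY rYV.
- move=> X Y [X1 MX1 [i [r ri]]] [Y1 MY1 [i' [r' ri']]].
  have [V [a [p [b [q bV]]]]] := biproduct_exists X Y.
  have [V1 [a1 [p1 [b1 [q1 bV1]]]]] := biproduct_exists X1 Y1.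
  exists V, a, p, b, q; split=> //; exists V1.
    by apply/(subcategory_biproduct Ms bV1).
  have [pa qb qa pb E] := fmap_biproduct (@tf_additive _ _ F) bV1.
  have [_ _ _ _ EV] := bV.
  exists (fmap F a1 \oc i \oc p + fmap F b1 \oc i' \oc q).
  exists (a \oc r \oc fmap F p1 + b \oc r' \oc fmap F q1).
  rewrite compDl !compDr -!compcA (compcA (fmap F p1)) pa (compcA (fmap F p1)) pb.
  rewrite (compcA (fmap F q1)) qa (compcA (fmap F q1)) qb.
  rewrite !comp0r !comp1c !compr0 addr0 add0r (compcA r) ri (compcA r') ri'.
  by rewrite !comp1c.
Qed.

End TriangleFunctor.

Section QuotientFacts.
Context (T U : triangulated_category) (S : set T) (F : triangle_functor T U).
Hypotheses (S_thick : thick S) (F_quotient : verdier_quotient S F).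

Lemma quotient_tri_iso (X Y Z : T) : tri X Y Z -> S Z -> isomorphic (F X) (F Y).
Proof.
move=> [f [g [h d]]] SZ; exists (fmap F f); apply: (quotient_iso F_quotient).
by exists Z, g, h.
Qed.

Lemma quotient_zero (X : T) : S X -> zero_object (F X).
Proof.
move=> SX; have [Z zZ] := zero_object_exists T.
apply: (zero_object_isomorphic (quotient_tri_iso (tri_zerol X zZ) SX)).
exact (fmap_zero_object (@tf_additive _ _ F) zZ).
Qed.

(** [f] vanishes after some [u] with cone in [S], hence factors through that cone. *)
Lemma quotient_kernel (X Y : T) (f : hom X Y) : fmap F f = 0 ->
  exists (C : T) (g : hom X C) (h : hom C Y), S C /\ f = h \oc g.
Proof.
rewrite -(fmap0 (@tf_additive _ _ F)) => /(quotient_faithful S_thick F_quotient).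
move=> [X' [u [[C [g [k [d SC]]]]]]]; rewrite comp0r => /(weak_cokernel d)[h <-].
by exists C, g, h.
Qed.

Lemma quotient_zeroV (X : T) : zero_object (F X) -> S X.
Proof.
move=> /zero_objectP; rewrite -fmap_id => /quotient_kernel[C [g [h [SC E]]]].
by apply: (thick_retract S_thick) SC; exists g, h.
Qed.

(** In a roof for the isomorphism both legs are inverted by [F], so both cones lie in [S], and
    membership in [V] passes along the two legs. *)
Lemma quotient_isomorphic_thick (V : set T) (X Y : T) : thick V -> S `<=` V ->
  isomorphic (F X) (F Y) -> V X -> V Y.
Proof.
move=> Vt SV [phi phii] VX.
have [X' [s [f [Ws E]]]] := quotient_roof S_thick F_quotient phi.
have [C [c [h [d SC]]]] := Ws.
have VX' : V X'.
  by apply: (thick_fiber Vt _ VX (SV _ SC)); exists s, c, h.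
have fi : is_iso (fmap F f).
  by rewrite -E; apply: is_iso_comp => //; apply: (quotient_iso F_quotient).
have [Z [g [k dZ]]] := dist_complete f.
apply: (thick_ext Vt (X := X') (Z := Z)) VX' _; first by exists f, g, k.
by apply/SV/quotient_zeroV; apply: (dist_iso_zero (tf_dist F dZ)).
Qed.

End QuotientFacts.

(** * Truncations of a thick subcategory with respect to a silting subcategory *)

Definition rperp (T : triangulated_category) (D : set T) : set T :=
  [set Y | forall A, D A -> forall i, (0 < i)%N -> homzero A (iter i (shift T) Y)].

Definition lperp (T : triangulated_category) (D : set T) : set T :=
  [set X | forall A, D A -> forall i, (0 < i)%N -> homzero X (iter i (shift T) A)].

Section Silting.
Context (T : triangulated_category) (S D : set T).
Hypotheses (S_thick : thick S) (D_silt : silt S D).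
Implicit Types X Y Z A B C V : T.

Local Notation "X \[ i ]" := (iter i (shift T) X) (at level 2, format "X \[ i ]").

(** Membership in [S] is demanded so that [F] inverts morphisms whose cone lies in
    [star negative D]. *)
Definition negative : set T :=
  [set A | S A /\ forall Y, rperp D Y -> forall i, homzero A Y\[i]].

Definition positive : set T :=
  [set B | forall X, lperp D X -> forall i, homzero X B\[i]].

Definition weights : set T := star negative (star D positive).

Lemma silt_subcat : subcategory D. Proof. by case: D_silt. Qed.

Lemma silt_in A : D A -> S A.
Proof. by case: D_silt => _ DS _ _ /DS. Qed.

Lemma silt_rperp A : D A -> rperp D A.
Proof. by move=> DA B DB i i0 f; case: D_silt => _ _ DD _; apply: DD f. Qed.

Lemma silt_lperp A : D A -> lperp D A.
Proof. by move=> DA B DB i i0 f; case: D_silt => _ _ DD _; apply: DD f. Qed.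

Lemma positive_iso : iso_closed positive.
Proof.
move=> X Y iXY PX Z lZ i.
apply: homzero_iso (isomorphic_refl _) _ (PX Z lZ i).
exact/iter_shift_iso/isomorphic_sym.
Qed.

Lemma negative_ext : ext_closed negative.
Proof.
move=> X Y Z t [SX NX] [SZ NZ]; split; first exact: (thick_ext S_thick t).
by move=> V rV i; apply: (homzero_extl t); [apply: NX | apply: NZ].
Qed.

Lemma positive_ext : ext_closed positive.
Proof.
move=> X Y Z t PX PZ V lV i.
by apply: (homzero_ext ((tri_iter_shift i _ _ _).2 t)); [apply: PX | apply: PZ].
Qed.

Lemma silt_ext : ext_closed D.
Proof.
move=> X Y Z t DX DZ.
have [|f [p [j [g b]]]] := tri_split t; first exact: (silt_rperp DX DZ (isT : 0 < 1)%N).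
exact/(subcategory_biproduct silt_subcat b).
Qed.

Lemma positive_rperp B : star D positive B -> rperp D B.
Proof.
move=> [A [B1 [DA PB1 t]]] V DV i i0.
apply: (homzero_ext ((tri_iter_shift i _ _ _).2 t)); first exact: silt_rperp.
by apply: PB1; apply: silt_lperp.
Qed.

(** [star_ext] applies twice. For the outer product, [star D positive] is right orthogonal to [D],
    and [negative] has no morphisms to shifts of such objects. *)
Lemma weights_ext : ext_closed weights.
Proof.
apply: star_ext; first exact: negative_ext.
- apply: star_ext; [exact: silt_ext | exact: positive_ext |].
  by move=> X Y DX PY; apply: (PY X _ 1%N); apply: silt_lperp.
- by move=> X Y [_ NX] /positive_rperp rY; apply: (NX Y _ 1%N).
Qed.

Lemma silt_zero Z : zero_object Z -> D Z.
Proof. exact: subcategory_zero silt_subcat. Qed.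

Lemma zero_negative Z : zero_object Z -> negative Z.
Proof.
move=> zZ; split; first exact: thick_zero S_thick _ zZ.
by move=> Y _ i f; apply: zZ.2.
Qed.

Lemma zero_positive Z : zero_object Z -> positive Z.
Proof.
move=> zZ Y _ i f; suff zZi : zero_object Z\[i] by apply: zZi.1.
by elim: i {f} => //= i; apply: zero_object_shift.
Qed.

Lemma negative_weights A : negative A -> weights A.
Proof.
move=> NA; have [Z zZ] := zero_object_exists T.
exists A, Z; split=> //; last exact: tri_zeror.
by exists Z, Z; split; [apply: silt_zero | apply: zero_positive | apply: tri_zeror].
Qed.

Lemma silt_weights A : D A -> weights A.
Proof.
move=> DA; have [Z zZ] := zero_object_exists T.
exists Z, A; split; [exact: zero_negative | | exact: tri_zerol].
by exists A, Z; split; [| apply: zero_positive | apply: tri_zeror].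
Qed.

Lemma positive_weights A : positive A -> weights A.
Proof.
move=> PA; have [Z zZ] := zero_object_exists T.
exists Z, A; split; [exact: zero_negative | | exact: tri_zerol].
by exists Z, A; split; [apply: silt_zero | | apply: tri_zerol].
Qed.

(* An isomorphism [C'[n]] = [C[m]] says that [C'] is the shift of [C] by the possibly
   negative integer [m - n]. *)
Definition all_weights : set T :=
  [set C | forall n m C', isomorphic C'\[n] C\[m] -> weights C'].

(** Strictly positive shifts of [A] are positive, strictly negative ones are negative, and [A]
    itself lies in the middle factor [D]. *)
Lemma silt_all_weights A : D A -> all_weights A.
Proof.
move=> DA n m C'; case: (ltngtP n m) => [nm|mn|->].
- rewrite -(subnKC nm) addSnnS iterD => /iter_shift_iso iC'.
  apply: positive_weights; apply: positive_iso (isomorphic_sym iC') _ => X lX i.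
  by rewrite -iterD; apply: lX => //; rewrite addnS.
- rewrite -(subnKC mn) addSnnS iterD => /iter_shift_iso iC'.
  apply: negative_weights; split.
    apply/(thick_iter_shift S_thick (n - m.+1).+1).
    exact: (thick_iso S_thick (isomorphic_sym iC')) (silt_in DA).
  move=> Y rY i; apply/(iter_shift_homzero (n - m.+1).+1).
  apply: (homzero_iso iC' (isomorphic_refl _)).
  by rewrite -iterD; apply: rY.
- by move=> /iter_shift_iso/isomorphic_sym iC'; apply: star_iso iC' _; apply: silt_weights.
Qed.

Lemma all_weights_ext : ext_closed all_weights.
Proof.
move=> X Y Z t EX EZ n m Y' iY'.
have [X' iX'] := iter_unshift n X\[m]; have [Z' iZ'] := iter_unshift n Z\[m].
apply: (@weights_ext X' Y' Z'); last by apply: EZ (isomorphic_sym iZ').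
  apply/(tri_iter_shift n); apply: tri_iso ((tri_iter_shift m _ _ _).2 t) => //.
  exact: isomorphic_sym.
by apply: EX (isomorphic_sym iX').
Qed.

Lemma all_weights_shift C : all_weights C <-> all_weights (shift T C).
Proof.
split=> EC n m C' iC'; first by apply: (EC n m.+1); rewrite iterSr.
by apply: (EC n.+1 m); rewrite -iterSr !iterS; apply: fmap_isomorphic.
Qed.

(** [all_weights] is closed under shifts and extensions; adding retracts makes it thick. *)
Definition retract_weights : set T := [set C | exists2 C', all_weights C' & retract C C'].

Lemma retract_weights_shift C : retract_weights C <-> retract_weights (shift T C).
Proof.
split=> [[C' EC' r]|[C' EC' r]].
  by exists (shift T C'); [apply: (all_weights_shift _).1 | apply/shift_retract].
have [C'' iC''] := unshift C'; exists C''.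
  apply: (all_weights_shift _).2 => n m V iV; apply: (EC' n m); apply: isomorphic_trans iV _.
  exact/iter_shift_iso/isomorphic_sym.
by apply/shift_retract; apply: retract_trans r _; apply: isomorphic_retract.
Qed.

(* [X -> Y] is a retract of the composite [X' -> X -> Y -> Y'], so its cone is a retract
   of the cone of the latter. *)
Lemma retract_weights_cone X Y Z :
  tri X Y Z -> retract_weights X -> retract_weights Y -> retract_weights Z.
Proof.
move=> [f [g [h d]]] [X' EX' [i [r ri]]] [Y' EY' [j [q qj]]].
have [Z' [g' [h' d']]] := dist_complete (j \oc f \oc r).
have [|u [ug hu]] := dist_morphism (u := i) (v := j) d d'.
  by rewrite -!compcA ri compc1.
have [|v [vg hv]] := dist_morphism (u := r) (v := q) d' d.
  by rewrite !compcA qj comp1c.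
exists Z'.
  apply: (@all_weights_ext Y' Z' (shift T X')) => //; last exact: (all_weights_shift _).1.
  by apply: tri_rotate; exists (j \oc f \oc r), g', h'.
(* [v \oc u] need not be the identity; its inverse corrects the retraction. *)
have [w [wvu _]] : is_iso (v \oc u).
  apply: (dist_endo_iso d).
    by rewrite -compcA ug compcA vg -compcA qj compc1.
  by rewrite compcA -hv -compcA -hu compcA -fmap_comp ri fmap_id comp1c.
by exists u, (w \oc v); rewrite -compcA.
Qed.

Lemma retract_weights_thick : thick retract_weights.
Proof.
apply: thick_intro.
- move=> Z zZ; exists Z; last exact: retract_refl.
  by apply: silt_all_weights; apply: silt_zero.
- by move=> X Y r [C EC rC]; exists C => //; apply: retract_trans r rC.
- exact: retract_weights_shift.
- move=> X Y Z /tri_rotate/tri_rotate t RX RZ.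
  apply: (retract_weights_shift _).2; apply: (retract_weights_cone t RZ).
  exact: (retract_weights_shift _).1.
Qed.

(** [retract_weights] is thick and contains [D], hence contains [S]; the shift by zero gives the
    decomposition of [C'] itself. *)
Lemma thick_weights C : S C -> exists2 C', weights C' & retract C C'.
Proof.
move=> /(silt_sub D_silt S_thick retract_weights_thick)[].
  by move=> A DA; exists A; [apply: silt_all_weights | apply: retract_refl].
by move=> C' EC' r; exists C' => //; apply: (EC' 0%N 0%N); apply: isomorphic_refl.
Qed.

(** Reassociated, [C'] lies in [(N * D) * P]; as [X] has no morphism to the part in [P], the
    morphism lifts to the part in [N * D]. *)
Lemma lperp_factor X C (g : hom X C) : lperp D X -> S C ->
  exists A (a : hom X A) (b : hom A C), star negative D A /\ g = b \oc a.
Proof.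
move=> lX /thick_weights[C' + [i [r ri]]].
rewrite /weights -star_assoc => -[A [B [NA PB [f [k [h d]]]]]].
have [|a aE] := weak_kernel d (k := i \oc g); first exact: (PB _ lX 0%N).
exists A, a, (r \oc f); split=> //.
by rewrite -compcA aE compcA ri comp1c.
Qed.

Lemma star_silt_in A : star negative D A -> S A.
Proof. by move=> [A1 [A0 [[SA1 _] /silt_in SA0 t]]]; apply: thick_ext t SA1 SA0. Qed.

Lemma star_silt_homzero A Y i : star negative D A -> rperp D Y -> (0 < i)%N ->
  homzero A Y\[i].
Proof.
move=> [A1 [A0 [[_ NA1] DA0 t]]] rY i0.
by apply: (homzero_extl t); [apply: NA1 | apply: rY].
Qed.

Lemma star_silt_factor A Y (f : hom A Y) : star negative D A -> rperp D Y ->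
  exists A0 (a : hom A A0) (b : hom A0 Y), D A0 /\ f = b \oc a.
Proof.
move=> [A1 [A0 [[_ NA1] DA0 [k [a [h d]]]]]] rY.
have [|b bE] := weak_cokernel d (k := f); first exact: (NA1 _ rY 0%N).
by exists A0, a, b.
Qed.

End Silting.

Section Reduction.
Context (T U : triangulated_category) (S D : set T) (F : triangle_functor T U).
Hypotheses (S_thick : thick S) (F_quotient : verdier_quotient S F).
Hypothesis D_silt : silt S D.
Implicit Types X Y Z A B C V : T.

Local Notation "X \[ i ]" := (iter i (shift T) X) (at level 2, format "X \[ i ]").

(** * Morphisms in the quotient between objects orthogonal to [D] *)

(** In a roof for [phi], the morphism from [X] to the cone of [s] factors through some [A] in
    [N * D]. The fibre [w] of [X -> A] therefore factors through [s] and can replace it as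
    denominator. *)
Lemma quotient_full X Y i (phi : hom (F X) (F Y\[i])) : lperp D X -> rperp D Y ->
  exists k : hom X Y\[i], fmap F k = phi.
Proof.
move=> lX rY.
have [X' [s [f [[C [c [h [d SC]]]] sf]]]] := quotient_roof S_thick F_quotient phi.
have [A [a [b [NA cE]]]] := lperp_factor S_thick D_silt c lX SC.
have [V [w [k dw]]] := dist_cocone a.
have [|l lE] := weak_kernel d (k := w).
  by rewrite cE -compcA (dist_comp0 dw) compr0.
(* The obstruction lies in Hom(A, Y[i+1]), which vanishes even for [i = 0]. *)
have [|m mE] := weak_extension dw (k := f \oc l).
  exact: (star_silt_homzero (i := i.+1) NA rY).
exists m; have [w' [_ ww']] : is_iso (fmap F w).
  apply: (quotient_iso F_quotient); exists A, a, k; split=> //.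
  exact: star_silt_in NA.
rewrite -[LHS]compc1 -[RHS]compc1 -ww' !compcA -fmap_comp mE.
by rewrite -lE !fmap_comp compcA sf.
Qed.

Lemma quotient_zero_factor X Y i (f : hom X Y\[i]) : lperp D X -> rperp D Y ->
  fmap F f = 0 -> exists A (a : hom X A) (b : hom A Y\[i]), star (negative S D) D A /\ f = b \oc a.
Proof.
move=> lX rY /(quotient_kernel S_thick F_quotient)[C [g [h [SC ->]]]].
have [A [a [b [NA ->]]]] := lperp_factor S_thick D_silt g lX SC.
by exists A, a, (h \oc b); rewrite compcA.
Qed.

Lemma quotient_zero_shift X Y i (f : hom X Y\[i]) : lperp D X -> rperp D Y ->
  (0 < i)%N -> fmap F f = 0 -> f = 0.
Proof.
move=> lX rY i0 /(quotient_zero_factor lX rY)[A [a [b [NA ->]]]].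
by rewrite (star_silt_homzero NA rY i0 b) comp0r.
Qed.

Lemma quotient_zero_silt X Y (f : hom X Y) : lperp D X -> rperp D Y ->
  fmap F f = 0 -> exists A (a : hom X A) (b : hom A Y), D A /\ f = b \oc a.
Proof.
move=> lX rY /(@quotient_zero_factor X Y 0 f lX rY)[A [a [b [NA ->]]]].
have [A0 [a0 [b0 [DA0 ->]]]] := star_silt_factor b NA rY.
by exists A0, (a0 \oc a), b0; rewrite compcA.
Qed.

(** * Silting subcategories containing [D] *)

Section Over.
Context (M : set T).
Hypotheses (M_silt : silt [set: T] M) (DM : D `<=` M).

Lemma over_lperp X : M X -> lperp D X.
Proof. by move=> MX A /DM MA i i0 f; case: M_silt => _ _ MM _; apply: MM f. Qed.

Lemma over_rperp X : M X -> rperp D X.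
Proof. by move=> MX A /DM MA i i0 f; case: M_silt => _ _ MM _; apply: MM f. Qed.

(** Orthogonality comes from fullness. For generation, a thick subcategory of [U] containing the
    image pulls back to a thick subcategory of [T] containing [M]. *)
Lemma image_silt : silt [set: U] (image_subcategory F M).
Proof.
have [Ms _ MM _] := M_silt; split=> //; first exact: image_subcategory_sub.
- move=> X Y /(image_subcategory_retract Ms)[X1 MX1 rX].
  move=> /(image_subcategory_retract Ms)[Y1 MY1 rY] i i0.
  apply: (homzero_retract rX ((iter_shift_retract i _ _).2 rY)).
  apply: (homzero_iso (isomorphic_refl _) (isomorphic_sym (tf_iter_shift F i Y1))) => phi.
  have [k <-] := quotient_full phi (over_lperp MX1) (over_rperp MY1).
  by rewrite (MM _ _ MX1 MY1 i i0 k); apply: (fmap0 (@tf_additive _ _ F)).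
- apply/seteqP; split=> // Z _ N [[Nt _] MN].
  have [X iX] := quotient_ess_surj S_thick F_quotient Z.
  apply: (thick_iso Nt iX); move: X {iX}.
  suff : [set: T] `<=` [set X | N (F X)] by move=> H X; apply: H.
  apply: (silt_sub M_silt _ (tf_preimage_thick F Nt)); first exact: thick_intro.
  by move=> X MX; exact: (MN _ (@image_subcategory_mem _ _ F M X MX)).
Qed.

End Over.

Lemma image_inj (M M' : set T) : silt [set: T] M -> D `<=` M ->
  silt [set: T] M' -> D `<=` M' ->
  image_subcategory F M `<=` image_subcategory F M' -> M `<=` M'.
Proof.
move=> Msilt DM M'silt DM' MM' X MX.
have [M's _ _ _] := M'silt.
have /MM'/(image_subcategory_retract M's)[Y M'Y [i [r ri]]] :=
  @image_subcategory_mem _ _ F M X MX.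
have lX := over_lperp Msilt DM MX; have rX := over_rperp Msilt DM MX.
have lY := over_lperp M'silt DM' M'Y; have rY := over_rperp M'silt DM' M'Y.
have [a aE] := @quotient_full X Y 0 i lX rY.
have [b bE] := @quotient_full Y X 0 r lY rX.
(* [idc X - b \oc a] is killed by [F], hence equals [v \oc u] through [A] in [D]; the pairs [(a, u)]
   and [(b, v)] make [X] a retract of the biproduct of [Y] and [A]. *)
have [|A [u [v [DA uv]]]] := quotient_zero_silt (f := idc X - b \oc a) lX rX.
  by rewrite (fmapB (@tf_additive _ _ F)) fmap_comp fmap_id aE bE ri subrr.
have [V [j [p [k [q bV]]]]] := biproduct_exists Y A.
have [pj qk qj pk _] := bV.
apply: (subcategory_retract M's (Y := V)).
  exists (j \oc a + k \oc u), (b \oc p + v \oc q).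
  rewrite compDl !compDr -!compcA (compcA p) pj (compcA p) pk (compcA q) qj (compcA q) qk.
  by rewrite !comp0r !comp1c !compr0 addr0 add0r -uv addrC subrK.
by apply/(subcategory_biproduct M's bV); split=> //; apply: DM'.
Qed.

(** * Lifting objects of the quotient *)

(** Filtrations by the degree above which morphisms vanish; [rlevel 0] is [rperp D] and [llevel 0]
    is [lperp D]. *)
Definition rlevel n : set T :=
  [set X | forall A, D A -> forall i, (n < i)%N -> homzero A X\[i]].

Definition llevel n : set T :=
  [set X | forall A, D A -> forall i, (n < i)%N -> homzero X A\[i]].

Definition eventually_rlevel : set T := [set X | exists n, rlevel n X].

Definition eventually_llevel : set T := [set X | exists n, llevel n X].

Lemma eventually_rlevel_thick : thick eventually_rlevel.
Proof.
apply: thick_intro.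
- move=> Z zZ; exists 0%N => A DA i i0.
  exact: (silt_rperp D_silt (silt_zero D_silt zZ) DA i0).
- move=> X Y rXY [n rY]; exists n => A DA i ni.
  by apply: homzero_retract (retract_refl A) _ (rY A DA i ni); apply/iter_shift_retract.
- move=> X; split=> -[n rX].
    by exists n => A DA i ni; rewrite -iterSr; apply: rX => //; apply: leqW.
  exists n.+1 => A DA [//|i] ni; rewrite iterSr; exact: rX.
- move=> X Y Z t [n rX] [m rZ]; exists (maxn n m) => A DA i.
  rewrite gtn_max => /andP[ni mi].
  by apply: (homzero_ext ((tri_iter_shift i _ _ _).2 t)); [apply: rX | apply: rZ].
Qed.

Lemma eventually_llevel_thick : thick eventually_llevel.
Proof.
apply: thick_intro.
- move=> Z zZ; exists 0%N => A DA i i0.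
  exact: (silt_lperp D_silt (silt_zero D_silt zZ) DA i0).
- move=> X Y rXY [n rY]; exists n => A DA i ni.
  exact: homzero_retract rXY (retract_refl _) (rY A DA i ni).
- move=> X; split=> -[n rX].
    by exists n.+1 => A DA [//|i] ni; rewrite iterS; apply/shift_homzero; apply: rX.
  by exists n => A DA i ni; apply/shift_homzero; rewrite -iterS; apply: rX => //; apply: leqW.
- move=> X Y Z t [n rX] [m rZ]; exists (maxn n m) => A DA i.
  rewrite gtn_max => /andP[ni mi].
  by apply: (homzero_extl t); [apply: rX | apply: rZ].
Qed.

Lemma silt_eventually_rlevel C : S C -> eventually_rlevel C.
Proof.
apply: (silt_sub D_silt S_thick eventually_rlevel_thick) => A DA.
by exists 0%N => B DB i; apply: (silt_rperp D_silt DA DB).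
Qed.

Lemma silt_eventually_llevel C : S C -> eventually_llevel C.
Proof.
apply: (silt_sub D_silt S_thick eventually_llevel_thick) => A DA.
by exists 0%N => B DB i; apply: (silt_lperp D_silt DA DB).
Qed.

(** * Right orthogonal lifts from contravariant finiteness *)

Section Right.
Hypothesis S_contra : contravariantly_finite S.

(** Every morphism from [A] in [D] to [X[i]] factors through the shifted approximation [C[i]], and
    the object [C] of [S] is bounded. *)
Lemma contra_eventually_rlevel X : eventually_rlevel X.
Proof.
have [C [f fa]] := S_contra X; have [SC _] := fa.
have [n rC] := silt_eventually_rlevel SC; exists n => A DA i ni g.
have [a [_ aP]] := right_approximation_iter i S_thick fa.
have [h <-] := aP A (silt_in D_silt DA) g.
by rewrite (rC A DA i ni h) compr0.
Qed.

(** The [S]-approximation is cut down to a right [D]-approximation [b : A -> Y], whose cone is [Y']: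
    morphisms from [D] lift to the part of [C'] in [N * D], and that part maps to [Y] through
    [A]. *)
Lemma right_step Y : rperp D Y -> exists A Y',
  [/\ D A, tri A Y Y' & forall B, D B -> forall i, homzero B Y'\[i]].
Proof.
move=> rY; have [C [f [SC fP]]] := S_contra Y.
have [C' + [j [r rj]]] := thick_weights S_thick D_silt SC.
rewrite /weights -star_assoc => -[A' [B' [NA' PB' [k [l [h d]]]]]].
have [A [a [b [DA bE]]]] := star_silt_factor (f \oc r \oc k) NA' rY.
have bP B (g : hom B Y) : D B -> exists g', b \oc g' = g.
  move=> DB; have [g1 g1E] := fP B (silt_in D_silt DB) g.
  have [|g2 g2E] := weak_kernel d (k := j \oc g1).
    exact: (PB' _ (silt_lperp D_silt DB) 0%N).
  by exists (a \oc g2); rewrite compcA -bE -!compcA g2E (compcA r) rj comp1c.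
have [Y' [c [h' d']]] := dist_complete b.
exists A, Y'; split=> //; first by exists b, c, h'.
move=> B DB [|i].
  move=> /= g; have [|g1 <-] := weak_kernel (proj1 (dist_rotate _ _ _) d') (k := g).
    exact: (silt_rperp D_silt DA DB (isT : 0 < 1)%N).
  by have [g2 <-] := bP _ g1 DB; rewrite compcA (dist_comp0 d') comp0r.
have t : tri Y Y' (shift T A) by apply: tri_rotate; exists b, c, h'.
apply: (homzero_ext ((tri_iter_shift i.+1 _ _ _).2 t)); first exact: rY.
by rewrite -iterSr; apply: (silt_rperp D_silt).
Qed.

Lemma right_lower n X : rlevel n.+1 X ->
  exists Z, isomorphic (F X) (F Z) /\ rlevel n Z.
Proof.
move=> rX.
have rY : rperp D X\[n.+1].
  move=> A DA i i0; rewrite -iterD; apply: rX => //.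
  by rewrite -[X in (X < _)%N]add0n ltn_add2r.
have [A [Y' [DA t YP]]] := right_step rY.
have [Z iZ] := iter_unshift n.+1 Y'; have [A1 iA1] := iter_unshift n.+1 A.
have tX : tri A1 X Z.
  by apply/(tri_iter_shift n.+1); apply: tri_iso t => //; apply: isomorphic_refl.
exists Z; split.
  apply: (quotient_tri_iso F_quotient (tri_rotate tX)).
  apply: (thick_shift S_thick _).1; apply: (thick_iter_shift S_thick n.+1 _).2.
  exact: (thick_iso S_thick iA1) (silt_in D_silt DA).
(* For the smallest [i], namely [n.+1], the vanishing of Hom(B, Y') in degree 0 is what is used. *)
move=> B DB i ni; rewrite -(subnK ni) iterD.
apply: homzero_iso (isomorphic_refl _) _ (YP B DB (i - n.+1)%N).
exact/iter_shift_iso/isomorphic_sym.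
Qed.

Lemma contra_rperp X : exists Z, isomorphic (F X) (F Z) /\ rperp D Z.
Proof.
have [n] := contra_eventually_rlevel X.
elim: n X => [|n IH] X rX; first by exists X; split=> //; apply: isomorphic_refl.
have [Y [iXY rY]] := right_lower rX; have [Z [iYZ rZ]] := IH Y rY.
by exists Z; split=> //; apply: isomorphic_trans iXY iYZ.
Qed.

End Right.

(** * Left orthogonal lifts from covariant finiteness *)

Section Left.
Hypothesis S_cov : covariantly_finite S.

Lemma cov_eventually_llevel X : eventually_llevel X.
Proof.
have [C [f fa]] := S_cov X; have [SC _] := fa.
have [n rC] := silt_eventually_llevel SC; exists n => A DA i ni g.
have SA : S A\[i] := (thick_iter_shift S_thick i A).1 (silt_in D_silt DA).
by have [h <-] := fa.2 _ SA g; rewrite (rC A DA i ni h) comp0r.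
Qed.

(** Dually, [Y] maps to the [D * P] part of [C'], and left orthogonality lifts this to [c : Y -> A],
    a left [D]-approximation with fibre [Y']. *)
Lemma left_step Y : lperp D Y -> exists A Y',
  [/\ D A, tri Y' Y A & forall B, D B -> forall i, homzero Y' B\[i]].
Proof.
move=> lY; have [C [f [SC fP]]] := S_cov Y.
have [C' [A' [B' [[_ NA'] PB' [k [l [h d]]]]]] [j [r rj]]] := thick_weights S_thick D_silt SC.
have [A [B1 [DA PB1 [a [b [h1 d1]]]]]] := PB'.
have [|c cE] := weak_kernel d1 (k := l \oc j \oc f).
  exact: (PB1 _ lY 0%N).
have cP B (g : hom Y B) : D B -> exists g', g' \oc c = g.
  move=> DB; have [g1 g1E] := fP B (silt_in D_silt DB) g.
  have [|g2 g2E] := weak_cokernel d (k := g1 \oc r).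
    exact: (NA' _ (silt_rperp D_silt DB) 0%N).
  by exists (g2 \oc a); rewrite -compcA cE !compcA g2E -(compcA g1) rj compc1.
have [Y' [e [h' d']]] := dist_cocone c.
exists A, Y'; split=> //; first by exists e, c, h'.
move=> B DB [|i].
  move=> /= g; have [|g1 <-] := weak_extension d' (k := g).
    exact: (silt_rperp D_silt DB DA (isT : 0 < 1)%N).
  by have [g2 <-] := cP _ g1 DB; rewrite -compcA (dist_comp0 d') compr0.
have t : tri Y (A) (shift T Y') by apply: tri_rotate; exists e, c, h'.
apply/(iter_shift_homzero 1).
apply: (homzero_extl (tri_rotate t)); first exact: (silt_rperp D_silt _ _ (isT : 0 < i.+2)%N).
by apply/(iter_shift_homzero 1); apply: lY.
Qed.

Lemma left_lower n X : llevel n.+1 X -> rperp D X ->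
  exists Z, [/\ isomorphic (F X) (F Z), llevel n Z & rperp D Z].
Proof.
move=> lX rX; have [Y iY] := iter_unshift n.+1 X.
have lY : lperp D Y.
  move=> A DA i i0; apply/(iter_shift_homzero n.+1); rewrite -iterD.
  apply: (homzero_iso (isomorphic_sym iY) (isomorphic_refl _)); apply: lX => //.
  by rewrite addnC -[X in (X < _)%N]add0n ltn_add2r.
have [A [Y' [DA t YP]]] := left_step lY.
have tX : tri Y'\[n.+1] X A\[n.+1].
  apply: (tri_iso (isomorphic_refl _) (isomorphic_sym iY) (isomorphic_refl _)).
  exact/tri_iter_shift.
exists Y'\[n.+1]; split.
- apply: isomorphic_sym; apply: (quotient_tri_iso F_quotient tX).
  exact: (thick_iter_shift S_thick n.+1 A).1 (silt_in D_silt DA).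
- move=> B DB i ni; rewrite -(subnKC ni) iterD.
  by apply/iter_shift_homzero; apply: YP.
(* Right orthogonality survives because the new object is an extension of [X] by [A[n]] and Hom(B,
   A[n+i]) vanishes for [i > 0]. *)
- move=> B DB i i0; have t' : tri A\[n] Y'\[n.+1] X by apply: tri_rotateV.
  apply: (homzero_ext ((tri_iter_shift i _ _ _).2 t')); last exact: rX.
  by rewrite -iterD; apply: (silt_rperp D_silt) => //; rewrite addn_gt0 i0.
Qed.

Lemma cov_lperp X : rperp D X ->
  exists Z, [/\ isomorphic (F X) (F Z), lperp D Z & rperp D Z].
Proof.
have [n] := cov_eventually_llevel X.
elim: n X => [|n IH] X lX rX; first by exists X; split=> //; apply: isomorphic_refl.
have [Y [iXY lY rY]] := left_lower lX rX; have [Z [iYZ lZ rZ]] := IH Y lY rY.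
by exists Z; split=> //; apply: isomorphic_trans iXY iYZ.
Qed.

End Left.

(** For [V] thick and containing [S], membership in [V] depends only on the image under [F], so this
    is the essential image of [V]. *)
Definition essential_image_thick (V : set T) : set U :=
  [set Z | forall W : T, isomorphic (F W) Z -> V W].

Lemma essential_image_thickP (V : set T) : thick V -> S `<=` V ->
  thick (essential_image_thick V).
Proof.
move=> Vt SV; have VF := quotient_isomorphic_thick S_thick F_quotient Vt SV.
have Fsurj := quotient_ess_surj S_thick F_quotient.
apply: thick_intro.
- move=> Z zZ W iW; apply/SV/(quotient_zeroV S_thick F_quotient).
  exact: zero_object_isomorphic (isomorphic_sym iW) zZ.
- move=> X Y rXY VY W iW; have [W' iW'] := Fsurj Y.
  have [i [r ri]] : retract (F W) (F W').
    apply: retract_trans (isomorphic_retract iW) _; apply: retract_trans rXY _.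
    exact/isomorphic_retract/isomorphic_sym.
  have [Z [g [h d]]] := dist_complete i.
  have [p [j b]] := dist_split d (dist_retraction d ri).
  (* The complement of [F W] in [F W'] is lifted to [W'']; the biproduct of [W] and [W''] then has
     the image of [W'], so it lies in [V], and so does its summand [W]. *)
  have [W'' iW''] := Fsurj Z.
  have [B [i1 [p1 [j1 [q1 b1]]]]] := biproduct_exists W W''.
  have iB : isomorphic (F W') (F B).
    apply: biproduct_isomorphic b (fmap_biproduct (@tf_additive _ _ F) b1) _ _.
      exact: isomorphic_refl.
    exact: isomorphic_sym.
  have VB := VF _ _ iB (VY _ iW').
  by have [] := (subcategory_biproduct (thick_sub Vt) b1).1 VB.
- move=> Z; split=> VZ W iW.
    have [W1 iW1] := unshift W.
    apply: (thick_iso Vt (isomorphic_sym iW1)); apply: (thick_shift Vt _).1; apply: VZ.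
    apply/shift_isomorphic; apply: isomorphic_trans iW.
    apply: isomorphic_trans (isomorphic_sym (tf_shift_isomorphic F W1)) _.
    exact/fmap_isomorphic/isomorphic_sym.
  apply: (thick_shift Vt _).2; apply: VZ.
  apply: isomorphic_trans (tf_shift_isomorphic F W) _.
  exact: fmap_isomorphic.
- move=> X Y Z [f [g [h d]]] VX VZ W iW.
  have [A [u iu]] := Fsurj X; have [v [v' [v'v vv']]] := iW.
  (* A roof lifts the first morphism of the triangle to [k : A' -> W], whose cone has image
     isomorphic to [Z]. *)
  have [A' [s [k [Ws kE]]]] := quotient_roof S_thick F_quotient (v' \oc f \oc u).
  have [C [c [e dk]]] := dist_complete k.
  have VA' : V A'.
    have [B [b [b' [db SB]]]] := Ws.
    by apply: (thick_fiber Vt (Y := A) _ (VX A (ex_intro _ u iu)) (SV _ SB)); exists s, b, b'.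
  apply: (thick_ext Vt (X := A') (Z := C)) => //; first by exists k, c, e.
  apply: VZ; apply: (dist_morphism_iso (u := u \oc fmap F s) (v := v) (tf_dist F dk) d).
  + by rewrite -kE !compcA vv' comp1c.
  + by apply: is_iso_comp => //; apply: (quotient_iso F_quotient).
  + by exists v'.
Qed.

Definition preimage_perp (N : set U) : set T := [set X | N (F X)] `&` (lperp D `&` rperp D).

(** * The inverse map *)

Section Preimage.
Context (N : set U) (N_silt : silt [set: U] N) (S_finite : functorially_finite S).
Local Notation M := (preimage_perp N).

Lemma preimage_perp_lift (Z : U) : N Z -> exists2 X, M X & isomorphic (F X) Z.
Proof.
move=> NZ; have [Ns _ _ _] := N_silt.
have [X iX] := quotient_ess_surj S_thick F_quotient Z.
have [Y [iXY rY]] := contra_rperp S_finite.1 X.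
have [V [iYV lV rV]] := cov_lperp S_finite.2 rY.
have iV : isomorphic (F V) Z.
  by apply: isomorphic_trans iX; apply: isomorphic_sym; apply: isomorphic_trans iXY iYV.
by exists V => //; split=> //; apply: (subcategory_iso Ns (isomorphic_sym iV)).
Qed.

Lemma silt_preimage_perp : D `<=` M.
Proof.
move=> A DA; split; last by split; [exact: (silt_lperp D_silt DA) | exact: (silt_rperp D_silt DA)].
have [Ns _ _ _] := N_silt; apply: (subcategory_zero Ns).
by apply: (quotient_zero F_quotient); apply: (silt_in D_silt DA).
Qed.

Lemma preimage_perp_sub : subcategory M.
Proof.
have [Ns _ _ _] := N_silt; apply: subcategory_intro.
- by move=> Z zZ; apply: silt_preimage_perp; apply: (silt_zero D_silt).
- move=> X Y rXY [NY [lY rY]]; split; first exact: (subcategory_retract Ns (fmap_retract F rXY)).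
  split=> A DA i i0.
    exact: homzero_retract rXY (retract_refl _) (lY A DA i i0).
  apply: homzero_retract (retract_refl _) _ (rY A DA i i0).
  exact/iter_shift_retract.
- move=> X Z [NX [lX rX]] [NZ [lZ rZ]].
  have [Y [i [p [j [q b]]]]] := biproduct_exists X Z.
  exists Y, i, p, j, q; split=> //; have t := biproduct_tri b; split.
    by apply/(subcategory_biproduct Ns (fmap_biproduct (@tf_additive _ _ F) b)).
  split=> A DA n n0.
    by apply: (homzero_extl t); [apply: lX | apply: lZ].
  by apply: (homzero_ext ((tri_iter_shift n _ _ _).2 t)); [apply: rX | apply: rZ].
Qed.

(** A thick [V] containing [preimage_perp N] contains [D], hence [S], so its essential image is
    thick; this image contains [N], hence is all of [U]. *)
Lemma preimage_perp_silt : silt [set: T] M.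
Proof.
have [Ns _ NN _] := N_silt; split=> //; first exact: preimage_perp_sub.
- move=> X Y [NX [lX _]] [NY [_ rY]] i i0 f.
  apply: (quotient_zero_shift lX rY i0).
  apply: (homzero_iso (isomorphic_refl _) (tf_iter_shift F i Y)) => g.
  exact: NN NX NY i i0 g.
- apply/seteqP; split=> // X _ V [[Vt _] MV].
  have SV : S `<=` V.
    by apply: (silt_sub D_silt S_thick Vt) => A /silt_preimage_perp/MV.
  suff NV : N `<=` essential_image_thick V.
    have := silt_sub N_silt (thick_intro _ _ _ _) (essential_image_thickP Vt SV) NV.
    by move=> /(_ _ _ _ _ (F X) I); apply=> //; apply: isomorphic_refl.
  move=> Z /preimage_perp_lift[Y MY iY] W iW.
  apply: (quotient_isomorphic_thick S_thick F_quotient Vt SV) (MV Y MY).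
  exact: isomorphic_trans iY (isomorphic_sym iW).
Qed.

Lemma image_preimage_perp : image_subcategory F M = N.
Proof.
have [Ns _ _ _] := N_silt; apply/seteqP; split=> Z.
  by move=> /(_ N); apply; split=> // _ [X [NX _] <-].
move=> /preimage_perp_lift[X MX iX].
apply: (subcategory_iso (image_subcategory_sub F M) iX).
exact: (@image_subcategory_mem _ _ F M X MX).
Qed.

End Preimage.
End Reduction.

Theorem theorem2p37 (T U : triangulated_category) (S : set T)
    (F : triangle_functor T U)
    (T_krull_schmidt : krull_schmidt T)
    (S_thick : thick S)
    (F_quotient : verdier_quotient S F) :
  (contravariantly_finite S ->
   forall D : set T, silt S D ->
     set_fun [set M : set T | silt [set: T] M /\ D `<=` M] (silt [set: U])
             (image_subcategory F) /\
     set_inj [set M : set T | silt [set: T] M /\ D `<=` M]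
             (image_subcategory F)) /\
  (functorially_finite S ->
   forall D : set T, silt S D ->
     set_bij [set M : set T | silt [set: T] M /\ D `<=` M] (silt [set: U])
             (image_subcategory F)).
Proof.
have fun_image D : silt S D -> set_fun [set M : set T | silt [set: T] M /\ D `<=` M]
    (silt [set: U]) (image_subcategory F).
  by move=> Dsilt M [Msilt DM]; apply: (image_silt S_thick F_quotient Dsilt).
have inj_image D : silt S D -> set_inj [set M : set T | silt [set: T] M /\ D `<=` M]
    (image_subcategory F).
  move=> Dsilt M M' /set_mem[Msilt DM] /set_mem[M'silt DM'] E.
  by apply/seteqP; split; apply: (image_inj S_thick F_quotient Dsilt); rewrite // E.
split=> [_ D Dsilt|S_finite D Dsilt]; first by split; [apply: fun_image | apply: inj_image].
split; [exact: fun_image | exact: inj_image | move=> N N_silt].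
exists (preimage_perp D F N); last exact: (image_preimage_perp S_thick F_quotient Dsilt).
split; first exact: (preimage_perp_silt S_thick F_quotient Dsilt).
exact: (silt_preimage_perp F_quotient Dsilt N_silt).
Qed.
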